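(* Suppose $(K,v,\sigma)$ is an existentially closed valued difference field. Then $\mathcal O^\times$ is a pure $\mathbb Z[\sigma]$-submodule of $K^\times$. It follows that every valued difference field embeds into one with a cross-section commuting with $\sigma$, that is, one admitting a group homomorphism $s\colon\Gamma\to K^\times$ with $v(s(\gamma))=\gamma$ and $s(\sigma(\gamma))=\sigma(s(\gamma))$ for all $\gamma\in\Gamma$.
   Context: A valued difference field $(K,v,\sigma)$ is a valued field with surjective valuation $v\colon K\to\Gamma\cup\{\infty\}$ ($\Gamma$ the value group, written additively; the trivial valuation is allowed), valuation ring $\mathcal O$, residue field $k$, residue map $\operatorname{res}$, together with a (surjective) field automorphism $\sigma$ of $K$ with $\sigma(\mathcal O)=\mathcal O$. It induces automorphisms of the ordered abelian group $\Gamma$ and of the field $k$, also denoted $\sigma$, such that $v\circ\sigma=\sigma\circ v$ and $\operatorname{res}\circ\sigma=\sigma\circ\operatorname{res}$. Valued difference fields are regarded as structures in the three-sorted language $\mathcal L_\sigma$ with sorts $\mathrm{VF}$ (the valued field), $\Gamma$ (including $\infty$), $k$; field operations including $(-)^{-1}$ (with $0^{-1}=0$) on $\mathrm{VF}$ and $k$; $+,0,-,<,\infty$ on $\Gamma$; the maps $v\colon\mathrm{VF}\to\Gamma$ and $\operatorname{res}\colon\mathrm{VF}\to k$ (set to be $0$ outside $\mathcal O$); and $\sigma,\sigma^{-1}$ on each sort. Embeddings are embeddings of such structures, i.e. valued field embeddings commuting with $\sigma$. $(K,v,\sigma)$ is existentially closed if, for every embedding $f$ of it into a valued difference field $N$,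 every tuple $a$ from $K$ (any sorts), and every quantifier-free $\mathcal L_\sigma$-formula $\phi(x,y)$ without parameters, if $N\models\exists x\,\phi(x,f(a))$ then $K\models\exists x\,\phi(x,a)$. $K^\times$ is a module over the polynomial ring $\mathbb Z[\sigma]$ via $\left(\sum_{i=0}^n m_i\sigma^i\right)\cdot z=\prod_{i=0}^n\sigma^i(z^{m_i})$, and $\mathcal O^\times$ is a submodule. A submodule $N$ of an $R$-module $M$ is pure if for every matrix $A\in\operatorname{Mat}_{d\times n}(R)$ and every $b\in N^d$, if $A\cdot x=b$ has a solution in $M^n$ then it has one in $N^n$. *)

(* Defs.v *)
From HB Require Import structures.
From mathcomp Require Import all_boot all_order all_algebra.

Set Implicit Arguments.
Unset Strict Implicit.
Unset Printing Implicit Defensive.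

Import Order.TTheory GRing.Theory Num.Theory.
Local Open Scope ring_scope.

(* Ordered abelian groups, written additively; the trivial group is one. *)
Record oagType := OAG {
  oag :> porderZmodType;
  oag_total : total (<=%R : rel oag);
  oag_lerD : forall x y z : oag, x <= y -> z + x <= z + y
}.

(* G together with a top element: [None] stands for infinity. *)
Definition infty_add (G : oagType) (a b : option G) : option G :=
  if a is Some x then (if b is Some y then Some (x + y) else None) else None.

(* Convention: - infinity = infinity. *)
Definition infty_opp (G : oagType) (a : option G) : option G :=
  omap (fun x => - x) a.

Definition infty_le (G : oagType) (a b : option G) : bool :=
  if b is Some y then (if a is Some x then x <= y else false) else true.

Definition infty_lt (G : oagType) (a b : option G) : bool := ~~ infty_le b a.

Definition infty_min (G : oagType) (a b : option G) : option G :=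
  if infty_le a b then a else b.

Definition in_valring (F : fieldType) (G : oagType) (v : F -> option G) (x : F)
  : bool := infty_le (Some 0) (v x).

(* The residue field is given as an abstract field [rf] with a map [res] that,
   on the valuation ring, is a surjective ring morphism whose kernel is the
   maximal ideal; this determines it up to a unique isomorphism. *)
Record valuedField := ValuedField {
  vf :> fieldType;
  vg : oagType;
  rf : fieldType;
  vval : vf -> option vg;
  res : vf -> rf;
  vval_infty : forall x, vval x = None <-> x = 0;
  vvalM : forall x y, vval (x * y) = infty_add (vval x) (vval y);
  vvalD : forall x y, infty_le (infty_min (vval x) (vval y)) (vval (x + y));
  vval_surj : forall g : vg, exists x, vval x == Some g;
  res1 : res 1 = 1;
  resD : forall x y, in_valring vval x -> in_valring vval y ->
    res (x + y) = res x + res y;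
  resM : forall x y, in_valring vval x -> in_valring vval y ->
    res (x * y) = res x * res y;
  res_eq0 : forall x, in_valring vval x ->
    (res x = 0 <-> infty_lt (Some 0) (vval x));
  res_surj : forall r : rf, exists x, in_valring vval x && (res x == r);
  res_out : forall x, ~~ in_valring vval x -> res x = 0
}.

Record vdField := VDField {
  vd_base :> valuedField;
  sigma : {rmorphism vd_base -> vd_base};
  sigmaV : vd_base -> vd_base;
  sigmaK : cancel sigma sigmaV;
  sigmaVK : cancel sigmaV sigma;
  sigma_valring : forall x, in_valring (@vval vd_base) (sigma x)
                            = in_valring (@vval vd_base) x
}.

(* The maps induced on the value group and on the residue field by f : K -> K,
   computed on a lift; they are used for f = sigma and f = sigma^-1 only, where
   they do not depend on the lift (see [vval_sigma], [res_sigma], [vval_sigmaV],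
   [res_sigmaV] below), and where the default value 0 is never reached. *)
Definition induced_vg (K : valuedField) (f : K -> K) (g : vg K) : vg K :=
  odflt 0 (vval (f (xchoose (vval_surj g)))).

Definition induced_rf (K : valuedField) (f : K -> K) (r : rf K) : rf K :=
  res (f (xchoose (res_surj r))).

Definition sigma_vg (K : vdField) : vg K -> vg K := induced_vg (@sigma K).
Definition sigmaV_vg (K : vdField) : vg K -> vg K := induced_vg (@sigmaV K).
Definition sigma_rf (K : vdField) : rf K -> rf K := induced_rf (@sigma K).
Definition sigmaV_rf (K : vdField) : rf K -> rf K := induced_rf (@sigmaV K).

Lemma oag_lerD2 (G : oagType) (z x y : G) : (z + x <= z + y) = (x <= y).
Proof.
apply/idP/idP => [h|]; last exact: oag_lerD.
by have := oag_lerD (- z) h; rewrite !addKr.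
Qed.

Lemma vval0 (K : valuedField) : vval (0 : K) = None.
Proof. exact/vval_infty. Qed.

Lemma vval1 (K : valuedField) : vval (1 : K) = Some 0.
Proof.
have := vvalM (1 : K) 1; rewrite mul1r.
case E: (vval (1 : K)) => [g|]; last first.
  by move/vval_infty: E => /eqP; rewrite oner_eq0.
by case=> /eqP; rewrite -subr_eq0 opprD addNKr oppr_eq0 => /eqP ->.
Qed.

Definition valued_aut (K : valuedField) (f : K -> K) : Prop :=
  [/\ f 0 = 0, {morph f : x y / x - y}, {morph f : x y / x * y}, injective f
    & forall x, in_valring (@vval K) (f x) = in_valring (@vval K) x].

Lemma sigma_valued_aut (K : vdField) : valued_aut (@sigma K).
Proof.
split; [exact: rmorph0|exact: rmorphB|exact: rmorphM|exact: fmorph_inj|].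
exact: sigma_valring.
Qed.

Lemma sigmaV_valued_aut (K : vdField) : valued_aut (@sigmaV K).
Proof.
have inj : injective (sigma K) := can_inj (@sigmaK K).
have VK := @sigmaVK K.
split.
- by apply: inj; rewrite VK rmorph0.
- by move=> x y; apply: inj; rewrite rmorphB !VK.
- by move=> x y; apply: inj; rewrite rmorphM !VK.
- exact: can_inj VK.
- by move=> x; rewrite -[in RHS](VK x) sigma_valring.
Qed.

Lemma vval_quot (K : valuedField) (x y : K) : vval x = vval y -> y != 0 ->
  vval (x / y) = Some 0.
Proof.
move=> exy y0; have: vval (x / y * y) = vval y by rewrite divfK.
rewrite vvalM; case Ey: (vval y) => [g|]; last first.
  by move/vval_infty: Ey y0 => ->; rewrite eqxx.
case: (vval (x / y)) => [h|] //= [] /eqP.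
by rewrite -subr_eq0 addrK => /eqP ->.
Qed.

Lemma vval0P (K : valuedField) (x : K) : x != 0 ->
  in_valring (@vval K) x -> in_valring (@vval K) x^-1 -> vval x = Some 0.
Proof.
move=> x0; rewrite /in_valring.
have: vval (x * x^-1) = Some 0 by rewrite divff // vval1.
rewrite vvalM; case: (vval x) => [a|//]; case: (vval x^-1) => [b|//] /= [ab] a0 b0.
congr Some; apply: le_anti; rewrite a0 andbT.
by rewrite -ab -[leLHS]addr0 oag_lerD2.
Qed.

Lemma vval_aut_congr (K : valuedField) (f : K -> K) (x y : K) :
  valued_aut f -> vval x = vval y -> vval (f x) = vval (f y).
Proof.
case=> f0 fB fM finj fO exy; case: (eqVneq y 0) => [y0|y0].
  have: x = 0 by apply/vval_infty; rewrite exy; apply/vval_infty.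
  by move=> ->; rewrite y0.
have x0 : x != 0.
  by apply/eqP => x0; move/vval_infty: x0; rewrite exy => /vval_infty/eqP; apply/negP.
have nz z : z != 0 -> f z != 0 by apply: contraNneq => fz; apply/eqP/finj; rewrite fz f0.
have f1 : f 1 = 1.
  apply: (mulfI (nz 1 (oner_neq0 _))); by rewrite -fM !mulr1.
have fV z : z != 0 -> f z^-1 = (f z)^-1.
  by move=> z0; apply: (mulfI (nz z z0)); rewrite -fM !divff ?nz.
have xy0 : x / y != 0 by rewrite mulf_neq0 ?invr_eq0.
have h : vval (f (x / y)) = Some 0.
  apply: vval0P; [exact: nz| by rewrite fO /in_valring vval_quot //=|].
  by rewrite -fV // fO /in_valring invf_div vval_quot //=.
rewrite -[x](divfK y0) fM vvalM h; case: (vval (f y)) => [g|] //=.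
by rewrite add0r.
Qed.

Lemma res_aut_congr (K : valuedField) (f : K -> K) (x y : K) :
  valued_aut f -> in_valring (@vval K) x -> in_valring (@vval K) y ->
  res x = res y -> res (f x) = res (f y).
Proof.
case=> f0 fB fM finj fO xO yO exy.
have opO z : in_valring (@vval K) z -> in_valring (@vval K) (- z).
  have vN1 : vval (-1 : K) = Some 0.
    have: vval (-1 * -1 : K) = Some 0 by rewrite mulrNN mulr1 vval1.
    rewrite vvalM; case: (vval (-1 : K)) => [g|//] /= [gg]; congr Some.
    case/orP: (oag_total g 0) => g0; apply: le_anti; rewrite g0 ?andbT /=.
      by rewrite -gg -[leRHS]addr0 oag_lerD2.
    by rewrite -gg -[leLHS]addr0 oag_lerD2.
  by rewrite /in_valring -mulN1r vvalM vN1; case: (vval z) => [g|] //=; rewrite add0r.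
have DO z w : in_valring (@vval K) z -> in_valring (@vval K) w ->
    in_valring (@vval K) (z + w).
  rewrite /in_valring => zO wO; have := vvalD z w; rewrite /infty_min.
  case: ifP => _; case: (vval (z + w)) => [c|//].
    by move: zO; case: (vval z) => [a|//] /=; apply: le_trans.
  by move: wO; case: (vval w) => [a|//] /=; apply: le_trans.
have dO := DO _ _ xO (opO _ yO).
have resB z w : in_valring (@vval K) z -> in_valring (@vval K) w ->
    res (z - w) = res z - res w.
  move=> zO wO; apply/eqP; rewrite eq_sym subr_eq -resD ?subrK //.
  exact: DO _ _ zO (opO _ wO).
have unitP z : in_valring (@vval K) z -> (res z == 0) = ~~ (vval z == Some 0).
  move=> zO; apply/eqP/idP => [/(res_eq0 zO)|h].
    by apply: contraTneq => ->; rewrite /infty_lt /= lexx.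
  apply/res_eq0 => //; move: zO h; rewrite /in_valring /infty_lt.
  case: (vval z) => [a|//] /= a0; apply: contra => a0'.
  by apply/eqP; congr Some; apply: le_anti; rewrite a0 a0'.
apply/eqP; rewrite -subr_eq0 -resB ?fO // -fB unitP ?fO //.
have: res (x - y) == 0 by rewrite resB // exy subrr.
rewrite unitP //; apply: contra => /eqP fd; apply/eqP.
have d0 : x - y != 0.
  by apply/eqP => d0; move: fd; rewrite d0 f0 vval0.
have fd0 : f (x - y) != 0.
  by apply: contra d0 => /eqP fd0; apply/eqP/finj; rewrite fd0 f0.
have f1 : f 1 = 1.
  have n1 : f 1 != 0.
    by apply: contraNneq (oner_neq0 K) => f1; apply/eqP/finj; rewrite f1 f0.
  by apply: (mulfI n1); rewrite -fM !mulr1.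
apply: vval0P => //; rewrite -fO.
have -> : f (x - y)^-1 = (f (x - y))^-1.
  by apply: (mulfI fd0); rewrite -fM !divff.
have e : vval (1 : K) = vval (f (x - y)) by rewrite vval1 fd.
by rewrite -div1r /in_valring (vval_quot e fd0) /=.
Qed.

Lemma vval_induced (K : valuedField) (f : K -> K) (x : K) :
  valued_aut f -> vval (f x) = omap (induced_vg f) (vval x).
Proof.
move=> fA; case E: (vval x) => [g|] /=; last first.
  by move/vval_infty: E => ->; case: fA => -> *; apply/vval_infty.
have eg := eqP (xchooseP (vval_surj g)).
have e := vval_aut_congr fA (etrans E (esym eg)).
rewrite /induced_vg -e; case Ef: (vval (f x)) => [h|] //.
move/vval_infty: Ef; case: fA => f0 _ _ finj _; rewrite -f0 => /finj x0.
by move: E; rewrite x0 vval0.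
Qed.

Lemma res_induced (K : valuedField) (f : K -> K) (x : K) :
  valued_aut f -> in_valring (@vval K) x -> res (f x) = induced_rf f (res x).
Proof.
move=> fA xO; have /andP[zO /eqP ez] := xchooseP (res_surj (res x)).
exact: res_aut_congr fA xO zO (esym ez).
Qed.

Lemma vval_sigma (K : vdField) (x : K) :
  vval (sigma K x) = omap (@sigma_vg K) (vval x).
Proof. exact: vval_induced (sigma_valued_aut K). Qed.

Lemma vval_sigmaV (K : vdField) (x : K) :
  vval (sigmaV x) = omap (@sigmaV_vg K) (vval x).
Proof. exact: vval_induced (sigmaV_valued_aut K). Qed.

Lemma res0 (K : valuedField) : res (0 : K) = 0.
Proof.
by apply/res_eq0; rewrite /in_valring /infty_lt vval0.
Qed.

Lemma induced_rf0 (K : valuedField) (f : K -> K) :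
  valued_aut f -> induced_rf f 0 = 0.
Proof.
move=> fA; rewrite -[0 in LHS](res0 K) -res_induced //.
  by case: fA => -> *; apply: res0.
by rewrite /in_valring vval0.
Qed.

Lemma res_sigma (K : vdField) (x : K) : res (sigma K x) = sigma_rf (res x).
Proof.
have fA := sigma_valued_aut K.
case xO: (in_valring (@vval K) x); first exact: res_induced fA xO.
rewrite (res_out (negbT xO)) /sigma_rf induced_rf0 //.
by apply: res_out; rewrite sigma_valring xO.
Qed.

Lemma res_sigmaV (K : vdField) (x : K) : res (sigmaV x) = sigmaV_rf (res x).
Proof.
have fA := sigmaV_valued_aut K.
case xO: (in_valring (@vval K) x); first exact: res_induced fA xO.
rewrite (res_out (negbT xO)) /sigmaV_rf induced_rf0 //.
by apply: res_out; case: fA => _ _ _ _ ->; rewrite xO.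
Qed.

Inductive fsort := VF | RF.
Inductive lsort := Fld of fsort | VG.

Definition fld (K : vdField) (s : fsort) : fieldType :=
  match s with VF => vf K | RF => rf K end.

(* The sort VG includes infinity. *)
Definition carrier (K : vdField) (s : lsort) : Type :=
  match s with Fld s' => fld K s' | VG => option (vg K) end.

Definition lsigma (K : vdField) (s : lsort) : carrier K s -> carrier K s :=
  match s with
  | Fld VF => sigma K
  | Fld RF => @sigma_rf K
  | VG => omap (@sigma_vg K)
  end.

Definition lsigmaV (K : vdField) (s : lsort) : carrier K s -> carrier K s :=
  match s with
  | Fld VF => @sigmaV K
  | Fld RF => @sigmaV_rf K
  | VG => omap (@sigmaV_vg K)
  end.

(* [V s] is the type of variables of sort s. *)
Inductive term (V : lsort -> Type) : lsort -> Type :=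
| Var s : V s -> term V s
| FZero s : term V (Fld s)
| FOne s : term V (Fld s)
| FAdd s : term V (Fld s) -> term V (Fld s) -> term V (Fld s)
| FOpp s : term V (Fld s) -> term V (Fld s)
| FMul s : term V (Fld s) -> term V (Fld s) -> term V (Fld s)
| FInv s : term V (Fld s) -> term V (Fld s)
| GZero : term V VG
| GInfty : term V VG
| GAdd : term V VG -> term V VG -> term V VG
| GOpp : term V VG -> term V VG
| TVal : term V (Fld VF) -> term V VG
| TRes : term V (Fld VF) -> term V (Fld RF)
| TSigma s : term V s -> term V s
| TSigmaV s : term V s -> term V s.

Inductive qf_formula (V : lsort -> Type) : Type :=
| QFalse : qf_formula V
| QEq s : term V s -> term V s -> qf_formula V
| QLt : term V VG -> term V VG -> qf_formula V
| QNot : qf_formula V -> qf_formula V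
| QAnd : qf_formula V -> qf_formula V -> qf_formula V
| QOr : qf_formula V -> qf_formula V -> qf_formula V.

Fixpoint eval (K : vdField) (V : lsort -> Type)
    (e : forall s, V s -> carrier K s) (s : lsort) (t : term V s)
    : carrier K s :=
  match t in term _ s return carrier K s with
  | Var _ x => e _ x
  | FZero s => (0 : fld K s)
  | FOne s => (1 : fld K s)
  | FAdd s t1 t2 => (eval e t1 : fld K s) + eval e t2
  | FOpp s t1 => - (eval e t1 : fld K s)
  | FMul s t1 t2 => (eval e t1 : fld K s) * eval e t2
  | FInv s t1 => (eval e t1 : fld K s)^-1
  | GZero => Some 0
  | GInfty => None
  | GAdd t1 t2 => infty_add (eval e t1) (eval e t2)
  | GOpp t1 => infty_opp (eval e t1)
  | TVal t1 => @vval K (eval e t1)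
  | TRes t1 => @res K (eval e t1)
  | TSigma _ t1 => lsigma (eval e t1)
  | TSigmaV _ t1 => lsigmaV (eval e t1)
  end.

Fixpoint holds (K : vdField) (V : lsort -> Type)
    (e : forall s, V s -> carrier K s) (phi : qf_formula V) : Prop :=
  match phi with
  | QFalse => False
  | QEq _ t1 t2 => eval e t1 = eval e t2
  | QLt t1 t2 => infty_lt (eval e t1) (eval e t2)
  | QNot p => ~ holds e p
  | QAnd p q => holds e p /\ holds e q
  | QOr p q => holds e p \/ holds e q
  end.

Record embedding (K N : vdField) (f : forall s, carrier K s -> carrier N s)
    : Prop := Embedding {
  emb_inj : forall s, injective (f s);
  emb_0 : forall s, f (Fld s) (0 : fld K s) = (0 : fld N s);
  emb_1 : forall s, f (Fld s) (1 : fld K s) = (1 : fld N s);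
  emb_D : forall s (x y : fld K s),
    f (Fld s) (x + y) = (f (Fld s) x : fld N s) + f (Fld s) y;
  emb_N : forall s (x : fld K s), f (Fld s) (- x) = - (f (Fld s) x : fld N s);
  emb_M : forall s (x y : fld K s),
    f (Fld s) (x * y) = (f (Fld s) x : fld N s) * f (Fld s) y;
  emb_V : forall s (x : fld K s), f (Fld s) x^-1 = (f (Fld s) x : fld N s)^-1;
  emb_vg0 : f VG (Some 0) = Some 0;
  emb_vg_infty : f VG None = None;
  emb_vgD : forall a b, f VG (infty_add a b) = infty_add (f VG a) (f VG b);
  emb_vgN : forall a, f VG (infty_opp a) = infty_opp (f VG a);
  emb_vg_lt : forall a b, infty_lt (f VG a) (f VG b) = infty_lt a b;
  emb_val : forall x : K, f VG (vval x) = @vval N (f (Fld VF) x);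
  emb_res : forall x : K, f (Fld RF) (res x) = @res N (f (Fld VF) x);
  emb_sigma : forall s (x : carrier K s), f s (lsigma x) = lsigma (f s x);
  emb_sigmaV : forall s (x : carrier K s), f s (lsigmaV x) = lsigmaV (f s x)
}.

Definition stuple (K : vdField) (n : lsort -> nat) : Type :=
  forall s, 'I_(n s) -> carrier K s.

(* Variables of a formula phi(x, y): [inl] for the tuple x, with n s entries of
   sort s, and [inr] for the tuple y, with m s entries of sort s. *)
Definition vars2 (n m : lsort -> nat) (s : lsort) : Type :=
  ('I_(n s) + 'I_(m s))%type.

Definition env2 (K : vdField) (n m : lsort -> nat) (x : stuple K n)
    (y : stuple K m) (s : lsort) (i : vars2 n m s) : carrier K s :=
  match i with inl j => x s j | inr j => y s j end.

Definition existentially_closed (K : vdField) : Prop :=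
  forall (N : vdField) (f : forall s, carrier K s -> carrier N s),
  embedding f ->
  forall (n m : lsort -> nat) (a : stuple K m) (phi : qf_formula (vars2 n m)),
  (exists x : stuple N n, holds (env2 x (fun s j => f s (a s j))) phi) ->
  exists x : stuple K n, holds (env2 x a) phi.

Record mulgrp (K : vdField) := Mulgrp { mg_val : vf K; mg_neq0 : mg_val != 0 }.

HB.instance Definition _ (K : vdField) := [isSub for @mg_val K].
HB.instance Definition _ (K : vdField) := [Choice of mulgrp K by <:].

Lemma mg_one_proof (K : vdField) : (1 : vf K) != 0.
Proof. exact: oner_neq0. Qed.
Lemma mg_mul_proof (K : vdField) (x y : mulgrp K) : mg_val x * mg_val y != 0.
Proof. by rewrite mulf_neq0 ?mg_neq0. Qed.
Lemma mg_inv_proof (K : vdField) (x : mulgrp K) : (mg_val x)^-1 != 0.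
Proof. by rewrite invr_eq0 mg_neq0. Qed.

Definition mg_one (K : vdField) : mulgrp K := Mulgrp (mg_one_proof K).
Definition mg_mul (K : vdField) (x y : mulgrp K) : mulgrp K :=
  Mulgrp (mg_mul_proof x y).
Definition mg_inv (K : vdField) (x : mulgrp K) : mulgrp K :=
  Mulgrp (mg_inv_proof x).

Lemma mg_mulA (K : vdField) : associative (@mg_mul K).
Proof. by move=> x y z; apply/val_inj; rewrite /= mulrA. Qed.
Lemma mg_mulC (K : vdField) : commutative (@mg_mul K).
Proof. by move=> x y; apply/val_inj; rewrite /= mulrC. Qed.
Lemma mg_mul1 (K : vdField) : left_id (mg_one K) (@mg_mul K).
Proof. by move=> x; apply/val_inj; rewrite /= mul1r. Qed.
Lemma mg_mulV (K : vdField) : left_inverse (mg_one K) (@mg_inv K) (@mg_mul K).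
Proof. by move=> x; apply/val_inj; rewrite /= mulVf ?mg_neq0. Qed.

(* As a module, [mulgrp K] is written additively: its + is multiplication in K,
   and its 0 is 1. *)
HB.instance Definition _ (K : vdField) := GRing.isZmodule.Build (mulgrp K)
  (@mg_mulA K) (@mg_mulC K) (@mg_mul1 K) (@mg_mulV K).

(* (sum_i m_i sigma^i) . z = prod_i sigma^i (z ^ m_i), sigma being 'X. *)
Definition zsigma_act (K : vdField) (p : {poly int}) (z : vf K) : vf K :=
  \prod_(i < size p) iter i (sigma K) (z ^ p`_i).

Lemma zsigma_act_neq0 (K : vdField) (p : {poly int}) (z : mulgrp K) :
  zsigma_act p (mg_val z) != 0.
Proof.
apply/prodf_neq0 => i _.
have: mg_val z ^ p`_i != 0 by rewrite expfz_neq0 ?mg_neq0.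
move: (_ ^ _) => w; elim: (i : nat) => //= n IH h; by rewrite fmorph_eq0 IH.
Qed.

Definition mg_scale (K : vdField) (p : {poly int}) (z : mulgrp K) : mulgrp K :=
  Mulgrp (zsigma_act_neq0 p z).

Lemma iter_sigma1 (K : vdField) i : iter i (sigma K) 1 = 1.
Proof. by elim: i => //= i ->; rewrite rmorph1. Qed.
Lemma iter_sigmaM (K : vdField) i : {morph iter i (sigma K) : x y / x * y}.
Proof. by elim: i => // i IH x y; rewrite !iterS (IH x y) rmorphM. Qed.
Lemma iter_sigmaX (K : vdField) i (m : int) :
  {morph iter i (sigma K) : x / x ^ m}.
Proof. by elim: i => // i IH x; rewrite !iterS (IH x) fmorphXz. Qed.

Lemma zsigma_act_wide (K : vdField) n (p : {poly int}) (z : vf K) :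
  (size p <= n)%N -> zsigma_act p z = \prod_(i < n) iter i (sigma K) (z ^ p`_i).
Proof.
move=> le; rewrite /zsigma_act.
rewrite (big_ord_widen n (fun i => iter i (sigma K) (z ^ p`_i))) //.
rewrite big_mkcond; apply: eq_bigr => i _; case: ltnP => // le'.
by rewrite nth_default // expr0z iter_sigma1.
Qed.

Lemma zsigma_actDl (K : vdField) (p q : {poly int}) (z : vf K) : z != 0 ->
  zsigma_act (p + q) z = zsigma_act p z * zsigma_act q z.
Proof.
move=> z0; set n := maxn (size p) (size q).
rewrite !(@zsigma_act_wide _ n) ?leq_maxl ?leq_maxr ?size_polyD //.
rewrite -big_split; apply: eq_bigr => i _ /=.
by rewrite coefD expfzDr // iter_sigmaM.
Qed.

Lemma zsigma_actC (K : vdField) (c : int) (z : vf K) :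
  zsigma_act c%:P z = z ^ c.
Proof.
by rewrite (@zsigma_act_wide _ 1) ?size_polyC_leq1 // big_ord1 coefC.
Qed.

Lemma zsigma_actMX (K : vdField) (p : {poly int}) (z : vf K) :
  zsigma_act (p * 'X) z = sigma K (zsigma_act p z).
Proof.
rewrite (@zsigma_act_wide _ (size p).+1); last first.
  case: (eqVneq p 0) => [->|p0]; first by rewrite mul0r size_poly0.
  by rewrite size_mulX.
rewrite big_ord_recl /= coefMX expr0z mul1r rmorph_prod.
by apply: eq_bigr => i _; rewrite coefMX.
Qed.

Lemma zsigma_actCM (K : vdField) (c : int) (q : {poly int}) (z : vf K) :
  zsigma_act (c%:P * q) z = zsigma_act q z ^ c.
Proof.
rewrite (@zsigma_act_wide _ (size q)); last first.
  by rewrite mul_polyC size_scale_leq.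
have expM : {morph (fun x : vf K => x ^ c) : x y / x * y}.
  by move=> x y; rewrite expfzMl.
rewrite [in RHS]/zsigma_act (big_morph _ expM (exp1rz _ _)).
by apply: eq_bigr => i _; rewrite coefCM mulrC -iter_sigmaX exprz_exp.
Qed.

Lemma mg_scaleA (K : vdField) (p q : {poly int}) (z : mulgrp K) :
  mg_scale p (mg_scale q z) = mg_scale (p * q) z.
Proof.
apply/val_inj => /=; elim/poly_ind: p => [|p c IH].
  by rewrite mul0r /zsigma_act size_poly0 !big_ord0.
rewrite zsigma_actDl ?zsigma_act_neq0 // mulrDl zsigma_actDl ?mg_neq0 //.
by rewrite -mulrAC zsigma_actC zsigma_actCM !zsigma_actMX IH.
Qed.

Lemma mg_scale1 (K : vdField) : left_id 1 (@mg_scale K).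
Proof. by move=> z; apply/val_inj; rewrite /= zsigma_actC expr1z. Qed.

Lemma mg_scaleDr (K : vdField) : right_distributive (@mg_scale K) +%R.
Proof.
move=> p x y; apply/val_inj; rewrite /= -big_split; apply: eq_bigr => i _.
by rewrite expfzMl iter_sigmaM.
Qed.

Lemma mg_scaleDl (K : vdField) (z : mulgrp K) :
  {morph (@mg_scale K)^~ z : p q / p + q}.
Proof. by move=> p q; apply/val_inj; rewrite /= zsigma_actDl ?mg_neq0. Qed.

HB.instance Definition _ (K : vdField) :=
  GRing.Zmodule_isLmodule.Build {poly int} (mulgrp K)
    (@mg_scaleA K) (@mg_scale1 K) (@mg_scaleDr K) (@mg_scaleDl K).

Definition valunits (K : vdField) : pred (mulgrp K) :=
  fun z => in_valring (@vval K) (mg_val z) && in_valring (@vval K) (mg_val z)^-1.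

Lemma valunitsE (K : vdField) (z : mulgrp K) :
  (z \in @valunits K) = (vval (mg_val z) == Some 0).
Proof.
rewrite unfold_in; apply/andP/eqP => [[zO zVO]|e].
  exact: vval0P (mg_neq0 z) zO zVO.
have e1 : vval (1 : vf K) = vval (mg_val z) by rewrite vval1 e.
by rewrite -div1r /in_valring e (vval_quot e1 (mg_neq0 z)) /= lexx.
Qed.

Lemma valunits_submod (K : vdField) : submod_closed (@valunits K).
Proof.
have vM0 (x y : vf K) : vval x = Some 0 -> vval y = Some 0 ->
    vval (x * y) = Some 0.
  by move=> ex ey; rewrite vvalM ex ey /= addr0.
have valX0 (x : vf K) m : vval x = Some 0 -> vval (x ^ m) = Some 0.
  move=> ex; have x0 : x != 0.
    by apply: contra_eq_neq ex => ->; rewrite vval0.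
  have valXn n : vval (x ^+ n) = Some 0.
    by elim: n => [|n IH]; [rewrite expr0 vval1 | rewrite exprS vM0].
  case: m => n; first exact: valXn.
  rewrite NegzE -exprnN -exprVn -div1r.
  rewrite expr_div_n expr1n.
  by apply: vval_quot; rewrite ?expf_neq0 // vval1 valXn.
split; first by rewrite valunitsE /= vval1.
move=> p x y; rewrite !valunitsE => /eqP ex /eqP ey; apply/eqP.
apply: (vM0 _ _ _ ey); rewrite /= /zsigma_act.
apply: (big_ind (fun w => vval w = Some 0)) => [||i _]; [exact: vval1|exact: vM0|].
have := valX0 _ p`_i ex; move: (_ ^ _) => w.
elim: (i : nat) => //= n IH /IH e.
have e1 : vval (iter n (sigma K) w) = vval (1 : vf K) by rewrite e vval1.
by rewrite (vval_aut_congr (sigma_valued_aut K) e1) rmorph1 vval1.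
Qed.

(* [d] and [n] may be 0; a d-tuple of elements of M is a function on 'I_d. *)
Definition pure_submodule (R : pzRingType) (M : lmodType R) (N : {pred M})
    : Prop :=
  submod_closed N /\
  forall (d n : nat) (A : 'M[R]_(d, n)) (b : 'I_d -> M),
  (forall i, b i \in N) ->
  (exists x : 'I_n -> M, forall i, \sum_(j < n) A i j *: x j = b i) ->
  exists x : 'I_n -> M,
    (forall j, x j \in N) /\ forall i, \sum_(j < n) A i j *: x j = b i.

(* Additivity of s into [mulgrp K] means s (g + h) = s g * s h in K. *)
Definition has_sigma_cross_section (K : vdField) : Prop :=
  exists s : {additive vg K -> mulgrp K},
  forall g : vg K,
    vval (mg_val (s g)) = Some g /\
    mg_val (s (sigma_vg g)) = sigma K (mg_val (s g)).

(* Main.v *)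
From HB Require Import structures.
Require Import Defs.
From mathcomp Require Import all_boot all_order all_algebra.
From mathcomp Require Import generic_quotient ring_quotient fraction.
From mathcomp Require Import finmap monalg.
From Stdlib Require Import ClassicalEpsilon.

Set Implicit Arguments.
Unset Strict Implicit.
Unset Printing Implicit Defensive.

Import Order.TTheory GRing.Theory Num.Theory.
Local Open Scope ring_scope.

(** The point is that a cross-section commuting with sigma can be adjoined
    freely.  Let K be a valued difference field with value group Gamma, and let
    L be the field of fractions of the group ring of Gamma over K, whose
    monomials are written t^gamma.  The Gauss valuation

      v (sum_gamma a_gamma t^gamma) = min_gamma (v a_gamma + gamma)

    extends v, has the same value group, and gives t^gamma the value gamma.
    The rule sigma (a t^gamma) = sigma(a) t^(sigma gamma) extends sigma to L and
    respects this valuation, so K embeds in L, and gamma |-> t^gamma is a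
    cross-section of L commuting with sigma.  This is the second half of the
    theorem ([gauss_embedding], [gauss_cross_section]), for every K.

    The first half follows from it.  If s is a cross-section of L commuting
    with sigma, then z |-> z / s (v z) is a Z[sigma]-linear retraction of the
    multiplicative group of L onto the units of its valuation ring
    ([unit_part_sum], [unit_part_valunits], [unit_part_id]).  Hence it turns a
    solution in K of a system A x = b with unit right-hand side into a solution
    made of units, in L.  That A x = b has a solution in units is expressed by
    an existential formula with parameters b ([unit_system]), so an
    existentially closed K already contains such a solution
    ([existentially_closed_pure]).

    The one computation is the multiplicativity of the Gauss valuation
    ([gaussM]): among the terms of least value choose in each factor the one of
    least exponent; the product of these two terms cannot be cancelled.  This
    also shows that the group ring is a domain.

    Exponents are restricted to the nonnegative cone of Gamma, because the
    monoid algebra [{malg F[M]}] is defined for monoids M in which x + y = 0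
    forces x = y = 0.  The field of fractions is the same, and t^gamma becomes
    the quotient of the monomials of the positive and negative parts of gamma
    ([monomial]).  The residue field of L is taken to be the quotient of the
    valuation ring by its maximal ideal ([residue_field]). *)

Local Notation tofrac := (@FracField.tofrac _).

(** * The ordered monoid of values *)

Section InftyOrder.
Variable G : oagType.
Implicit Types a b c d : option G.

Lemma infty_le_refl a : infty_le a a.
Proof. by case: a => //= x; apply: lexx. Qed.

Lemma infty_le_trans b a c : infty_le a b -> infty_le b c -> infty_le a c.
Proof. by case: a b c => [x|] [y|] [z|] //=; apply: le_trans. Qed.

Lemma infty_le_anti a b : infty_le a b -> infty_le b a -> a = b.
Proof.
by case: a b => [x|] [y|] //= xy yx; congr Some; apply: le_anti; rewrite xy.
Qed.

Lemma infty_le_total a b : infty_le a b || infty_le b a.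
Proof. case: a b => [x|] [y|] //=; exact: (oag_total x y). Qed.

Lemma infty_ltW a b : infty_lt a b -> infty_le a b.
Proof. by rewrite /infty_lt; case/orP: (infty_le_total a b) => // ->. Qed.

Lemma infty_lt_le_trans b a c : infty_lt a b -> infty_le b c -> infty_lt a c.
Proof.
by rewrite /infty_lt => ab bc; apply: contra ab; apply: infty_le_trans.
Qed.

Lemma infty_min_lel a b : infty_le (infty_min a b) a.
Proof.
rewrite /infty_min; case: ifPn => [_|/infty_ltW //]; exact: infty_le_refl.
Qed.

Lemma infty_min_ler a b : infty_le (infty_min a b) b.
Proof. by rewrite /infty_min; case: ifP => // _; apply: infty_le_refl. Qed.

Lemma infty_le_min a b c :
  infty_le c (infty_min a b) = infty_le c a && infty_le c b.
Proof.
apply/idP/andP => [h|[ca cb]]; last by rewrite /infty_min; case: ifP.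
by split; apply: infty_le_trans h _; rewrite (infty_min_lel, infty_min_ler).
Qed.

Lemma infty_addC : commutative (@infty_add G).
Proof. by case=> [x|] [y|] //=; rewrite addrC. Qed.

Lemma infty_addA : associative (@infty_add G).
Proof. by case=> [x|] [y|] [z|] //=; rewrite addrA. Qed.

Lemma infty_add0 : left_id (Some 0) (@infty_add G).
Proof. by case=> [x|] //=; rewrite add0r. Qed.

Lemma infty_addAC a b c d :
  infty_add (infty_add a b) (infty_add c d)
  = infty_add (infty_add a c) (infty_add b d).
Proof. by rewrite -!infty_addA (infty_addA b) (infty_addC b) -infty_addA. Qed.

Lemma infty_le_addl z a b :
  infty_le (infty_add (Some z) a) (infty_add (Some z) b) = infty_le a b.
Proof. by case: a b => [x|] [y|] //=; rewrite oag_lerD2. Qed.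

Lemma infty_lt_addl z a b :
  infty_lt (infty_add (Some z) a) (infty_add (Some z) b) = infty_lt a b.
Proof. by rewrite /infty_lt infty_le_addl. Qed.

Lemma infty_leD a b c d : infty_le a b -> infty_le c d ->
  infty_le (infty_add a c) (infty_add b d).
Proof.
case: a b c d => [x|] [y|] [z|] [t|] //= xy zt.
apply: (le_trans (y := x + t)); first by rewrite oag_lerD2.
by rewrite -![_ + t]addrC oag_lerD2.
Qed.

Lemma infty_ltD a b c d : a != None -> c != None ->
  infty_le a b -> infty_le c d -> infty_lt a b || infty_lt c d ->
  infty_lt (infty_add a c) (infty_add b d).
Proof.
case: a c => [x|] // [z|] // _ _ ab cd /orP[h|h].
  apply: (infty_lt_le_trans (b := infty_add b (Some z))).
    by rewrite -![infty_add _ (Some z)]infty_addC infty_lt_addl.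
  exact: infty_leD (infty_le_refl _) cd.
apply: (infty_lt_le_trans (b := infty_add (Some x) d)).
  by rewrite infty_lt_addl.
exact: infty_leD ab (infty_le_refl _).
Qed.

End InftyOrder.

(** * Valuations on rings *)

Definition is_valuation (R : nzRingType) (G : oagType) (v : R -> option G) :=
  [/\ forall x, v x = None <-> x = 0,
      forall x y, v (x * y) = infty_add (v x) (v y)
    & forall x y, infty_le (infty_min (v x) (v y)) (v (x + y))].

Section Valuation.
Variables (R : nzRingType) (G : oagType) (v : R -> option G).
Hypothesis vP : is_valuation v.

Lemma valuation_None x : v x = None <-> x = 0.
Proof. by case: vP. Qed.

Lemma valuation_eq0 x : (v x == None) = (x == 0).
Proof. by apply/eqP/eqP => /valuation_None. Qed.

Lemma valuationM x y : v (x * y) = infty_add (v x) (v y).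
Proof. by case: vP. Qed.

Lemma valuationD x y : infty_le (infty_min (v x) (v y)) (v (x + y)).
Proof. by case: vP. Qed.

Lemma valuationD_ge c x y : infty_le c (v x) -> infty_le c (v y) ->
  infty_le c (v (x + y)).
Proof.
move=> cx cy; apply: infty_le_trans (valuationD x y).
by rewrite infty_le_min cx.
Qed.

Lemma valuationD_gt c x y : infty_lt c (v x) -> infty_lt c (v y) ->
  infty_lt c (v (x + y)).
Proof.
move=> cx cy; apply: infty_lt_le_trans (valuationD x y).
by rewrite /infty_min; case: ifP.
Qed.

Lemma valuation0 : v 0 = None.
Proof. by apply/eqP; rewrite valuation_eq0. Qed.

Lemma valuation_fin x : x != 0 -> exists g, v x = Some g.
Proof. by rewrite -valuation_eq0; case: (v x) => [g|] // _; exists g. Qed.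

Lemma valuation1 : v 1 = Some 0.
Proof.
have [g e] := valuation_fin (oner_neq0 R); have := valuationM 1 1.
by rewrite mulr1 e => -[/esym/eqP]; rewrite -subr_eq0 addrK => /eqP ->.
Qed.

Lemma valuationN x : v (- x) = v x.
Proof.
suff e : v (-1) = Some 0 by rewrite -mulN1r valuationM e infty_add0.
have [g e] : exists g, v (-1) = Some g.
  by apply: valuation_fin; rewrite oppr_eq0 oner_neq0.
have := valuationM (-1) (-1); rewrite mulrNN mulr1 valuation1 e => -[gg].
congr Some.
case/orP: (oag_total g 0) => g0; apply: le_anti; rewrite g0 ?andbT /=.
  by rewrite gg -[leRHS]addr0 oag_lerD2.
by rewrite gg -[leLHS]addr0 oag_lerD2.
Qed.

Lemma valuation_sum_gt I (r : seq I) (P : pred I) (F : I -> R) c :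
  c != None -> (forall i, P i -> infty_lt c (v (F i))) ->
  infty_lt c (v (\sum_(i <- r | P i) F i)).
Proof.
move=> c0 h; apply: (big_ind (fun x => infty_lt c (v x))) => //.
  by rewrite valuation0; case: (c) c0.
by move=> x y; apply: valuationD_gt.
Qed.

(** Otherwise x = (x + y) - y would have a value greater than v x. *)
Lemma valuationD_lt x y : infty_lt (v x) (v y) -> v (x + y) = v x.
Proof.
move=> xy; apply: infty_le_anti; last first.
  by apply: valuationD_ge; [apply: infty_le_refl | apply: infty_ltW].
have e : v x = v (x + y - y) by rewrite addrK.
have /orP[h|h] := infty_le_total (v (x + y)) (v y).
  by rewrite e; apply: valuationD_ge; rewrite ?valuationN ?infty_le_refl.
by move: xy; rewrite /infty_lt e valuationD_ge ?valuationN ?infty_le_refl.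
Qed.

End Valuation.

(** * The residue field of a valuation *)

Section ValuationRing.
Local Open Scope quotient_scope.
Variables (F : fieldType) (G : oagType) (v : F -> option G).
Hypothesis vP : is_valuation v.

(** The parameter ties the predicate to a proof that v is a valuation, from
    which its subring structure is inferred. *)
Definition valring_pred of is_valuation v : {pred F} := in_valring v.

Lemma valring_subring : subring_closed (valring_pred vP).
Proof.
split=> [|x y xO yO|x y xO yO]; rewrite unfold_in /valring_pred /in_valring.
- by rewrite (valuation1 vP) infty_le_refl.
- by apply: (valuationD_ge vP) => //; rewrite (valuationN vP).
- by rewrite (valuationM vP) -[Some 0]infty_add0; apply: infty_leD.
Qed.

HB.instance Definition _ :=
  GRing.isSubringClosed.Build F (valring_pred vP) valring_subring.

Record valring := Valring
  { valring_val : F; valringP : valring_pred vP valring_val }.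

HB.instance Definition _ := [isSub for valring_val].
HB.instance Definition _ := [Choice of valring by <:].
HB.instance Definition _ := [SubChoice_isSubComNzRing of valring by <:].

Definition maxideal : {pred valring} := fun x => infty_lt (Some 0) (v (val x)).

Lemma maxideal_idealr : idealr_closed maxideal.
Proof.
split; rewrite ?unfold_in /maxideal /=.
- by rewrite (valuation0 vP).
- by rewrite (valuation1 vP) /infty_lt infty_le_refl.
- move=> a x y; rewrite !unfold_in /= => x0 y0; apply: (valuationD_gt vP) => //.
  rewrite (valuationM vP); apply: infty_lt_le_trans x0 _.
  rewrite -[X in infty_le X _]infty_add0; apply: infty_leD (infty_le_refl _).
  exact: valringP.
Qed.

HB.instance Definition _ := isIdealr.Build valring maxideal maxideal_idealr.

Definition residue_field := {ideal_quot maxideal}.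
HB.instance Definition _ := GRing.ComNzRing.on residue_field.

Definition residue (x : F) : residue_field :=
  \pi_residue_field (insubd (0 : valring) x).

Lemma residue_pi (x : valring) : \pi_residue_field x = residue (val x).
Proof. by rewrite /residue valKd. Qed.

Lemma residueD x y : in_valring v x -> in_valring v y ->
  residue (x + y) = residue x + residue y.
Proof.
move=> xO yO.
rewrite -[x]/(val (Valring xO)) -[y]/(val (Valring yO)) -rmorphD -!residue_pi.
exact: rmorphD.
Qed.

Lemma residueM x y : in_valring v x -> in_valring v y ->
  residue (x * y) = residue x * residue y.
Proof.
move=> xO yO.
rewrite -[x]/(val (Valring xO)) -[y]/(val (Valring yO)) -rmorphM -!residue_pi.
exact: rmorphM.
Qed.

Lemma residue1 : residue 1 = 1.
Proof. by rewrite -(rmorph1 (val : valring -> F)) -residue_pi rmorph1. Qed.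

Lemma residue0 : residue 0 = 0.
Proof. by rewrite -(rmorph0 (val : valring -> F)) -residue_pi rmorph0. Qed.

Lemma residue_out x : ~~ in_valring v x -> residue x = 0.
Proof. by move=> xO; rewrite /residue /insubd insubN // rmorph0. Qed.

Lemma residue_surj (r : residue_field) :
  exists x, in_valring v x && (residue x == r).
Proof.
elim/quotW: r => x; exists (val x); rewrite residue_pi eqxx andbT.
exact: valringP.
Qed.

Lemma residue_eq0 x : in_valring v x ->
  (residue x = 0 <-> infty_lt (Some 0) (v x)).
Proof.
move=> xO; rewrite -[x]/(val (Valring xO)) -residue_pi.
rewrite -(rmorph0 (\pi_residue_field)).
by split=> [/eqP|h]; last apply/eqP; rewrite -Quotient.idealrBE subr0.
Qed.

(** When r = 0 the chosen lift x lies in the maximal ideal, so x^-1 is 0 or lies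
    outside the valuation ring; in both cases its residue is 0, the required
    value of the inverse at 0. *)
Definition residue_inv (r : residue_field) : residue_field :=
  residue (xchoose (residue_surj r))^-1.

Lemma residue_mulV (r : residue_field) : r != 0 -> residue_inv r * r = 1.
Proof.
rewrite /residue_inv; have /andP[] := xchooseP (residue_surj r).
move: (xchoose _) => x xO /eqP <- r0.
have vx : v x = Some 0.
  apply/esym/infty_le_anti => //.
  by apply: contraNT r0 => /residue_eq0 ->.
have x0 : x != 0 by rewrite -(valuation_eq0 vP) vx.
rewrite -residueM ?mulVf ?residue1 //.
have := valuationM vP x x^-1; rewrite divff // (valuation1 vP) vx infty_add0.
by rewrite /in_valring => <- /=; apply: lexx.
Qed.

Lemma residue_inv0 : residue_inv 0 = 0.
Proof.
rewrite /residue_inv; have /andP[] := xchooseP (residue_surj 0).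
move: (xchoose _) => x xO /eqP/residue_eq0 -/(_ xO) x0.
have [->|nx] := eqVneq x 0; first by rewrite invr0 residue0.
apply: residue_out; rewrite /in_valring.
have := valuationM vP x x^-1; rewrite divff // (valuation1 vP) => h.
apply: contraL x0 => h'; rewrite /infty_lt negbK.
rewrite h -[X in infty_le X _]infty_add0 infty_addC.
by apply: infty_leD (infty_le_refl _) h'.
Qed.

HB.instance Definition _ :=
  GRing.ComNzRing_isField.Build residue_field residue_mulV residue_inv0.

Hypothesis v_surj : forall g, exists x, v x == Some g.

Definition valued_field : valuedField :=
  @ValuedField F G residue_field v residue (valuation_None vP) (valuationM vP)
    (valuationD vP) v_surj residue1 residueD residueM residue_eq0 residue_surj
    residue_out.

End ValuationRing.

(** * Extending morphisms and valuations to fractions *)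

Section FractionField.
Variable D : idomainType.
Local Open Scope quotient_scope.

Lemma fraction_numden (x : {fraction D}) :
  x = tofrac (\n_(repr x)) / tofrac (\d_(repr x)).
Proof.
have d0 := denom_ratioP (repr x).
apply: (canRL (mulfK _)); first by rewrite tofrac_eq0.
rewrite -{1}[x]reprK /FracField.tofrac; unlock.
rewrite -[LHS]FracField.pi_mul; apply/eqmodP.
rewrite /= FracField.equivfE /FracField.mulf.
by rewrite !numden_Ratio ?oner_eq0 ?mulr1 // mulrC.
Qed.

Lemma fraction_cross (a b c d : D) : b != 0 -> d != 0 ->
  tofrac a / tofrac b = tofrac c / tofrac d ->
  a * d = c * b.
Proof.
move=> b0 d0 /eqP; rewrite eqr_div ?tofrac_eq0 // -!tofracM tofrac_eq.
by move/eqP.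
Qed.

Lemma fractionP (x : {fraction D}) : exists a b, b != 0 /\
  x = tofrac a / tofrac b.
Proof.
exists (\n_(repr x)), (\d_(repr x)); split; first exact: denom_ratioP.
exact: (fraction_numden x).
Qed.

Section Lift.
Variables (E : fieldType) (h : {rmorphism D -> E}).
Hypothesis h_inj : injective h.

Definition frac_lift of injective h : {fraction D} -> E :=
  fun x => h (\n_(repr x)) / h (\d_(repr x)).

Lemma frac_liftE a b : b != 0 ->
  frac_lift h_inj (tofrac a / tofrac b) = h a / h b.
Proof.
move=> b0; have h0 c : c != 0 -> h c != 0 by rewrite -(inj_eq h_inj) rmorph0.
rewrite /frac_lift; set x := tofrac a / _; have d0 := denom_ratioP (repr x).
apply/eqP; rewrite eqr_div ?h0 // -!rmorphM inj_eq //.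
exact/eqP/(fraction_cross d0 b0 (esym (fraction_numden x))).
Qed.

Lemma frac_lift_tofrac a : frac_lift h_inj (tofrac a) = h a.
Proof.
by rewrite -[tofrac a]divr1 -tofrac1 frac_liftE ?oner_eq0 // rmorph1 divr1.
Qed.

Lemma frac_lift_zmod : zmod_morphism (frac_lift h_inj).
Proof.
have h0 c : c != 0 -> h c != 0 by rewrite -(inj_eq h_inj) rmorph0.
move=> x y; have [a [b [b0 ->]]] := fractionP x.
have [c [d [d0 ->]]] := fractionP y.
rewrite -mulNr -tofracN addf_div ?tofrac_eq0 // -!tofracM -tofracD.
rewrite !frac_liftE ?mulf_neq0 // -mulNr addf_div ?h0 //.
by rewrite rmorphD !rmorphM rmorphN.
Qed.

Lemma frac_lift_monoid : monoid_morphism (frac_lift h_inj).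
Proof.
split; first by rewrite -tofrac1 frac_lift_tofrac rmorph1.
move=> x y; have [a [b [b0 ->]]] := fractionP x.
have [c [d [d0 ->]]] := fractionP y.
rewrite mulf_div -!tofracM !frac_liftE ?mulf_neq0 // mulf_div.
by rewrite !rmorphM.
Qed.

HB.instance Definition _ :=
  GRing.isZmodMorphism.Build _ _ (frac_lift h_inj) frac_lift_zmod.
HB.instance Definition _ :=
  GRing.isMonoidMorphism.Build _ _ (frac_lift h_inj) frac_lift_monoid.

End Lift.

Section Extend.
Variables (G : oagType) (w : D -> option G).
Hypothesis wP : is_valuation w.

Definition frac_val (x : {fraction D}) : option G :=
  infty_add (w (\n_(repr x))) (infty_opp (w (\d_(repr x)))).

(** Independence of the representation: if a / b = c / d then a d = c b, and the
    values of the denominators are finite, hence can be cancelled. *)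
Lemma frac_valE a b : b != 0 ->
  frac_val (tofrac a / tofrac b)
  = infty_add (w a) (infty_opp (w b)).
Proof.
set x := _ / _ => b0; rewrite /frac_val.
have d0 := denom_ratioP (repr x).
have := congr1 w (fraction_cross b0 d0 (fraction_numden x)).
rewrite !(valuationM wP).
have [g ->] := valuation_fin wP b0; have [k ->] := valuation_fin wP d0.
case: (w a) => [y|]; case: (w _) => [z|] //= [yz].
congr Some.
by apply/eqP; rewrite subr_eq addrAC eq_sym subr_eq yz.
Qed.

Lemma frac_val_tofrac a : frac_val (tofrac a) = w a.
Proof.
rewrite -[tofrac a]divr1 -tofrac1 frac_valE ?oner_eq0 //.
by rewrite (valuation1 wP) /= oppr0 infty_addC infty_add0.
Qed.

(** The ultrametric inequality for two fractions is the one for their numerators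
    over a common denominator. *)
Lemma frac_val_is_valuation : is_valuation frac_val.
Proof.
have frac_valM x y : frac_val (x * y) = infty_add (frac_val x) (frac_val y).
  have [a [b [b0 ->]]] := fractionP x.
  have [c [d [d0 ->]]] := fractionP y.
  rewrite mulf_div -!tofracM !frac_valE ?mulf_neq0 // !(valuationM wP).
  rewrite infty_addAC; congr infty_add.
  by case: (w b) (w d) => [y'|] [z|] //=; rewrite opprD.
split=> //.
  move=> x; have [a [b [b0 ->]]] := fractionP x; rewrite frac_valE //.
  have [g ->] := valuation_fin wP b0.
  split=> [h|/eqP]; last first.
    rewrite mulf_eq0 invr_eq0 !tofrac_eq0 (negPf b0) orbF => /eqP ->.
    by rewrite (valuation0 wP).
  have : w a = None by case: (w a) h.
  by move/(valuation_None wP) => ->; rewrite tofrac0 mul0r.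
move=> x y; have [a [b [b0 ->]]] := fractionP x.
have [c [d [d0 ->]]] := fractionP y.
have bd0 : b * d != 0 by rewrite mulf_neq0.
have -> : tofrac a / tofrac b
          = tofrac (a * d) / tofrac (b * d).
  by apply/eqP; rewrite eqr_div ?tofrac_eq0 // -!tofracM mulrAC mulrA.
have -> : tofrac c / tofrac d
          = tofrac (c * b) / tofrac (b * d).
  by apply/eqP; rewrite eqr_div ?tofrac_eq0 // -!tofracM mulrA.
rewrite -mulrDl -tofracD !frac_valE //.
have [g ->] := valuation_fin wP bd0.
rewrite ![infty_add _ (infty_opp _)]infty_addC.
have := valuationD wP (a * d) (c * b); rewrite /infty_min infty_le_addl.
by case: ifP => _; rewrite infty_le_addl.
Qed.

End Extend.
End FractionField.

(** * The nonnegative cone of an ordered group *)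

Lemma oag_subr_ge0 (G : oagType) (a b : G) : (0 <= b - a) = (a <= b).
Proof. by rewrite -(oag_lerD2 a 0) addr0 addrC subrK. Qed.

Record nneg (G : oagType) := Nneg { nneg_val : G; nneg_ge0 : 0 <= nneg_val }.

Section NonnegativeCone.
Variable G : oagType.
Implicit Types x y : nneg G.

HB.instance Definition _ := [isSub for @nneg_val G].
HB.instance Definition _ := [Choice of nneg G by <:].

Lemma oag_addr_ge0 (a b : G) : 0 <= a -> 0 <= b -> 0 <= a + b.
Proof.
by move=> a0 b0; apply: le_trans a0 _; rewrite -[leLHS]addr0 oag_lerD2.
Qed.

Definition nneg0 : nneg G := Nneg (lexx 0).
Definition nnegD x y : nneg G := Nneg (oag_addr_ge0 (nneg_ge0 x) (nneg_ge0 y)).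

Lemma nnegDA : associative nnegD.
Proof. by move=> x y z; apply/val_inj; rewrite /= addrA. Qed.
Lemma nneg0D : left_id nneg0 nnegD.
Proof. by move=> x; apply/val_inj; rewrite /= add0r. Qed.
Lemma nnegD0 : right_id nneg0 nnegD.
Proof. by move=> x; apply/val_inj; rewrite /= addr0. Qed.
Lemma nnegDC : commutative nnegD.
Proof. by move=> x y; apply/val_inj; rewrite /= addrC. Qed.
Lemma nnegD_eq0 x y : nnegD x y = nneg0 -> x = nneg0 /\ y = nneg0.
Proof.
suff h a b : nnegD a b = nneg0 -> a = nneg0.
  by move=> e; split; [apply: h e | apply: (h y x); rewrite nnegDC].
move=> [e]; apply/val_inj/le_anti; rewrite /= nneg_ge0 andbT.
by rewrite -(oag_lerD2 (nneg_val b)) addrC e addr0 nneg_ge0.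
Qed.

HB.instance Definition _ :=
  Choice_isMonomialDef.Build (nneg G) nnegDA nneg0D nnegD0 nnegD_eq0.
HB.instance Definition _ := MonomialDef_isConomialDef.Build (nneg G) nnegDC.

End NonnegativeCone.

Lemma exists_minimum (T : eqType) (r : rel T) (s : seq T) :
  total r -> transitive r -> s != [::] ->
  exists2 x, x \in s & forall y, y \in s -> r x y.
Proof.
move=> rT rt; elim: s => // a s IH _.
have raa : r a a by have := rT a a; rewrite orbb.
have [s0|/IH [x xs xm]] := eqVneq s [::].
  by rewrite s0; exists a; rewrite ?mem_head // => y; rewrite inE => /eqP ->.
case/orP: (rT a x) => ax.
  exists a; first exact: mem_head.
  by move=> y; rewrite inE => /predU1P[->//|/xm]; apply: rt.
exists x; first by rewrite inE xs orbT.
by move=> y; rewrite inE => /predU1P[->//|/xm].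
Qed.

(** * The Gauss valuation on a monoid algebra *)

Section GaussValuation.
Variables (F : fieldType) (G : oagType) (v : F -> option G).
Hypothesis vP : is_valuation v.
Local Notation A := {malg F[nneg G]}.
Implicit Types (f g : A) (i j k : nneg G).

Definition monom_val f k : option G := infty_add (Some (nneg_val k)) (v f@_k).

Definition gauss_val f : option G :=
  \big[@infty_min G/None]_(k <- msupp f) monom_val f k.

Lemma monom_val_None f k : (monom_val f k == None) = (f@_k == 0).
Proof. by rewrite -(valuation_eq0 vP) /monom_val; case: (v _). Qed.

(** The universal property of the minimum, from which all lower bounds are
    derived; exponents outside the support have infinite value and impose no
    condition. *)
Lemma gauss_geP c f :
  infty_le c (gauss_val f) <-> forall k, infty_le c (monom_val f k).
Proof.
have h (s : seq (nneg G)) :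
    infty_le c (\big[@infty_min G/None]_(k <- s) monom_val f k)
    = all (fun k => infty_le c (monom_val f k)) s.
  elim: s => [|k s IH]; first by rewrite big_nil; case: (c).
  by rewrite big_cons infty_le_min IH.
rewrite /gauss_val h; split=> [/allP H k|H]; last by apply/allP => k _.
have [/H //|] := boolP (k \in msupp f).
by rewrite -mcoeff_eq0 -monom_val_None => /eqP ->; case: (c).
Qed.

Lemma gauss_le f k : infty_le (gauss_val f) (monom_val f k).
Proof. exact: (gauss_geP _ f).1 (infty_le_refl _) k. Qed.

(** The leading exponent: the least one among those of least value.  It is the
    minimum of the support for the lexicographic comparison of values and then
    exponents, and this tie-breaking prevents cancellation in products. *)
Lemma gauss_lead f : f != 0 -> exists k,
  [/\ gauss_val f = monom_val f k, gauss_val f != None &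
    forall j, infty_le (monom_val f j) (monom_val f k) ->
      nneg_val k <= nneg_val j].
Proof.
move=> f0; pose r i j := infty_le (monom_val f i) (monom_val f j) &&
  (infty_le (monom_val f j) (monom_val f i) ==> (nneg_val i <= nneg_val j)).
have rT : total r.
  move=> i j; rewrite /r.
  have := infty_le_total (monom_val f i) (monom_val f j).
  by case: infty_le; case: infty_le => //= _; exact: (oag_total (nneg_val i)).
have rt : transitive r.
  move=> j i k /andP[ij /implyP ij'] /andP[jk /implyP jk'].
  apply/andP; split; first exact: infty_le_trans ij jk.
  apply/implyP => ki; apply: (le_trans (y := nneg_val j)).
    by apply: ij'; apply: infty_le_trans jk ki.
  by apply: jk'; apply: infty_le_trans ki ij.
have [|k kf km] := exists_minimum (s := msupp f) rT rt.
  by apply: contraNneq f0 => e; rewrite -msupp_eq0 -cardfs_eq0 e.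
have nk : monom_val f k != None by rewrite monom_val_None mcoeff_neq0.
have le j : infty_le (monom_val f k) (monom_val f j).
  have [/km/andP[]//|] := boolP (j \in msupp f).
  by rewrite -mcoeff_eq0 -monom_val_None => /eqP ->.
have e : gauss_val f = monom_val f k.
  by apply: infty_le_anti; [apply: gauss_le | apply/gauss_geP].
exists k; split=> //; first by rewrite e.
move=> j jk; have [/km/andP[_ /implyP]|] := boolP (j \in msupp f); first exact.
rewrite -mcoeff_eq0 -monom_val_None => /eqP ej; move: jk nk; rewrite ej.
by case: (monom_val f k).
Qed.

Lemma gaussU c k : gauss_val << c *g k >> = infty_add (Some (nneg_val k)) (v c).
Proof.
apply: infty_le_anti.
  by have := gauss_le << c *g k >> k; rewrite /monom_val mcoeffUU.
apply/gauss_geP => j; rewrite /monom_val mcoeffU.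
case: eqP => [<-|_]; first by rewrite mulr1n infty_le_refl.
by rewrite mulr0n (valuation0 vP) infty_addC.
Qed.

Lemma gauss0 : gauss_val 0 = None.
Proof. by rewrite /gauss_val msupp0 big_nil. Qed.

Lemma gaussD_ge c f g : infty_le c (gauss_val f) -> infty_le c (gauss_val g) ->
  infty_le c (gauss_val (f + g)).
Proof.
move=> /gauss_geP cf /gauss_geP cg; apply/gauss_geP => k.
have := cf k; have := cg k; rewrite /monom_val mcoeffD.
move=> h1 h2; have := valuationD vP f@_k g@_k.
rewrite -(infty_le_addl (nneg_val k)); apply: infty_le_trans.
by rewrite /infty_min; case: ifP.
Qed.

Lemma gauss_sum_ge I (s : seq I) (H : I -> A) c :
  (forall x : I, infty_le c (gauss_val (H x))) ->
  infty_le c (gauss_val (\sum_(x <- s) H x)).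
Proof.
move=> h; apply: (big_ind (fun x => infty_le c (gauss_val x))) => //.
  by rewrite gauss0; case: (c).
by move=> x y; apply: gaussD_ge.
Qed.

Lemma gaussM_ge f g :
  infty_le (infty_add (gauss_val f) (gauss_val g)) (gauss_val (f * g)).
Proof.
rewrite malgME; apply: gauss_sum_ge => i; apply: gauss_sum_ge => j.
rewrite gaussU (valuationM vP) -[Some _]/(infty_add (Some _) (Some _)).
by rewrite infty_addAC; apply: infty_leD; apply: gauss_le.
Qed.

Lemma mcoeffM_lead f g i j : f@_i != 0 -> g@_j != 0 ->
  (f * g)@_(mmul i j) - f@_i * g@_j
  = \sum_(i' <- msupp f | i' != i) \sum_(j' <- msupp g)
      (f@_i' * g@_j') *+ (mmul i' j' == mmul i j).
Proof.
rewrite !mcoeff_neq0 => fi gj.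
rewrite mcoeffMl (bigD1_seq i) ?fset_uniq //= (bigD1_seq j) ?fset_uniq //=.
rewrite eqxx mulr1n big1_seq => [|j' /andP[j'j _]].
  by rewrite addr0 addrAC subrr add0r.
case: eqP => // -[/addrI] e; case/eqP: j'j; exact: val_inj.
Qed.

(** With i and j the leading exponents of f and g, any other pair (i', j') of
    exponents with the same sum contributes a term of strictly larger value:
    if both values were least, then i <= i' and j <= j', which with equality of
    the sums gives i' = i.  So the coefficient at i + j has exactly the value of
    the product of the leading terms. *)
Lemma gaussM f g : gauss_val (f * g) = infty_add (gauss_val f) (gauss_val g).
Proof.
have [->|f0] := eqVneq f 0; first by rewrite mul0r gauss0.
have [->|g0] := eqVneq g 0; first by rewrite mulr0 gauss0 infty_addC.
apply: infty_le_anti; last exact: gaussM_ge.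
have [i [ei fin_f mini]] := gauss_lead f0.
have [j [ej fin_g minj]] := gauss_lead g0.
apply: infty_le_trans (gauss_le _ (mmul i j)) _.
suff -> : monom_val (f * g) (mmul i j) = infty_add (gauss_val f) (gauss_val g).
  exact: infty_le_refl.
rewrite ei ej /monom_val -infty_addAC -(valuationM vP); congr infty_add.
rewrite -[(f * g)@_ _](subrK (f@_i * g@_j)) addrC; apply: (valuationD_lt vP).
have fij : f@_i * g@_j != 0.
  by rewrite mulf_neq0 // -monom_val_None -?ei -?ej.
rewrite mcoeffM_lead -?monom_val_None -?ei -?ej //.
pose c := infty_add (gauss_val f) (gauss_val g).
have cE : infty_add (Some (nneg_val (mmul i j))) (v (f@_i * g@_j)) = c.
  by rewrite (valuationM vP) /c ei ej -infty_addAC.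
have low i' j' : i' != i -> mmul i' j' = mmul i j ->
    infty_lt (v (f@_i * g@_j)) (v (f@_i' * g@_j')).
  move=> i'i e; rewrite -(infty_lt_addl (nneg_val (mmul i j))) cE -e.
  rewrite (valuationM vP).
  rewrite -[Some _]/(infty_add (Some (nneg_val i')) (Some (nneg_val j'))).
  rewrite infty_addAC.
  apply: infty_ltD; rewrite ?gauss_le //.
  rewrite /infty_lt -negb_and; apply: contra i'i => /andP[hi hj].
  have li : nneg_val i <= nneg_val i' by apply: mini; rewrite -ei.
  have lj : nneg_val j <= nneg_val j' by apply: minj; rewrite -ej.
  apply/eqP/val_inj/le_anti; rewrite /= li andbT.
  rewrite -(oag_lerD2 (nneg_val j)) addrC.
  have <- : nneg_val i' + nneg_val j' = nneg_val j + nneg_val i.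
    by rewrite [RHS]addrC; case: e.
  by rewrite oag_lerD2.
have fin : v (f@_i * g@_j) != None by rewrite (valuation_eq0 vP).
apply: (valuation_sum_gt vP) => // i' i'i.
apply: (valuation_sum_gt vP) => // j' _.
case: eqP => [/(low _ _ i'i)|_]; rewrite ?mulr1n // mulr0n (valuation0 vP).
by case: (v _) fin.
Qed.

End GaussValuation.

(** * The monoid algebra is a domain *)

Section GaussRing.
Variables (F : fieldType) (G : oagType).
Local Notation A := {malg F[nneg G]}.

Lemma gauss_is_valuation (v : F -> option G) (vP : is_valuation v) :
  is_valuation (gauss_val v : A -> option G).
Proof.
split; [move=> f; split=> [|->]; last exact: gauss0|exact: gaussM|move=> f g].
  by apply: contra_eq => /(gauss_lead vP)[k [_]].
by apply: (gaussD_ge vP); rewrite (infty_min_lel, infty_min_ler).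
Qed.

(** Any valuation on F would show that the algebra has no zero divisors; the
    trivial one always exists. *)
Definition trivial_val (x : F) : option G := if x == 0 then None else Some 0.

Lemma trivial_is_valuation : is_valuation trivial_val.
Proof.
rewrite /trivial_val; split=> [x|x y|x y].
- by case: eqP.
- by rewrite mulf_eq0; case: eqP; case: eqP => //= _ _; rewrite addr0.
have [->|x0] := eqVneq x 0; first by rewrite add0r infty_min_ler.
have [->|y0] := eqVneq y 0; first by rewrite addr0 (negPf x0) infty_min_lel.
by rewrite /infty_min if_same; case: eqP => // _; apply: infty_le_refl.
Qed.

(** Invertibility is decided by excluded middle, which avoids determining the
    units; only the field of fractions of the algebra matters. *)
Definition malg_unit : pred A := fun f =>
  if excluded_middle_informative (exists g, g * f = 1) then true else false.

Definition malg_inv (f : A) : A :=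
  if malg_unit f then epsilon (inhabits 0) (fun g => g * f = 1) else f.

Lemma malg_mulVr : {in malg_unit, left_inverse 1 malg_inv *%R}.
Proof.
move=> f fu; rewrite /malg_inv (fu : malg_unit f = true).
apply: (epsilon_spec (inhabits 0) (fun g => g * f = 1)).
move: fu; rewrite unfold_in /malg_unit.
by case: excluded_middle_informative.
Qed.

Lemma malg_unitP (f g : A) : g * f = 1 -> malg_unit f.
Proof.
rewrite /malg_unit => e; case: excluded_middle_informative => // h.
by case: h; exists g.
Qed.

Lemma malg_inv_out : {in [predC malg_unit], malg_inv =1 id}.
Proof. by move=> f /negPf fu; rewrite /malg_inv (fu : malg_unit f = false). Qed.

HB.instance Definition _ := GRing.ComNzRing_hasMulInverse.Build A
  malg_mulVr malg_unitP malg_inv_out.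

Lemma malg_integral (f g : A) : f * g = 0 -> (f == 0) || (g == 0).
Proof.
have wP := gauss_is_valuation trivial_is_valuation.
rewrite -!(valuation_eq0 wP) => /(valuation_None wP); rewrite (valuationM wP).
by do 2!case: (gauss_val _ _).
Qed.

HB.instance Definition _ := GRing.ComUnitRing_isIntegral.Build A malg_integral.

End GaussRing.

(** * Extending an automorphism to the monoid algebra *)

Section MonomialMap.
Variables (F : fieldType) (G : oagType) (v : F -> option G).
Hypothesis vP : is_valuation v.
Variables (phi : {rmorphism F -> F}) (tau : {additive G -> G}).
Hypothesis tau_le : forall x y, (tau x <= tau y) = (x <= y).
Hypothesis phi_tau : forall x, v (phi x) = omap tau (v x).
Local Notation A := {malg F[nneg G]}.

Lemma tau_ge0 x : 0 <= x -> 0 <= tau x.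
Proof. by move=> x0; rewrite -(raddf0 tau) tau_le. Qed.

Definition nneg_map (k : nneg G) : nneg G := Nneg (tau_ge0 (nneg_ge0 k)).

Definition monom_map (k : nneg G) : A := << nneg_map k >>.

Lemma monom_map_mmorphism : mmorphism monom_map.
Proof.
split=> [j k|]; rewrite /monom_map.
  rewrite malgM_def fgmulUU mulr1; congr << _ >>.
  by apply/val_inj; rewrite /= raddfD.
by congr << _ >>; apply/val_inj; rewrite /= raddf0.
Qed.

HB.instance Definition _ :=
  isMultiplicative.Build _ _ monom_map monom_map_mmorphism.

Definition malg_map : A -> A := mmap (malgC \o phi) monom_map.

HB.instance Definition _ := GRing.RMorphism.on malg_map.

Lemma malg_mapU c k : malg_map << c *g k >> = << phi c *g nneg_map k >>.
Proof. by rewrite /malg_map mmapU /= malgM_def fgmulUU mulr1 mul1m. Qed.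

Lemma malg_mapE f :
  malg_map f = \sum_(k <- msupp f) << phi f@_k *g nneg_map k >>.
Proof.
rewrite /malg_map mmapE; apply: eq_bigr => k _.
by rewrite malgM_def fgmulUU mulr1 mul1m.
Qed.

Lemma malg_map_coef f k : (malg_map f)@_(nneg_map k) = phi f@_k.
Proof.
rewrite malg_mapE [in RHS](monalgE f) !raddf_sum /=.
apply: eq_bigr => j _ /=; rewrite !mcoeffU raddfMn.
congr (_ *+ _); congr nat_of_bool.
apply/eqP/eqP => [[e]|->//]; apply/val_inj/le_anti => /=.
by rewrite -tau_le e lexx -tau_le e lexx.
Qed.

(** The coefficient of the image at the exponent tau k is the image of the
    coefficient at k, so the map tau relates the values term by term. *)
Lemma gauss_map f : gauss_val v (malg_map f) = omap tau (gauss_val v f).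
Proof.
have tau_val k :
    monom_val v (malg_map f) (nneg_map k) = omap tau (monom_val v f k).
  rewrite /monom_val malg_map_coef phi_tau; case: (v _) => //= a.
  by rewrite raddfD.
have tau_infty a b : infty_le (omap tau a) (omap tau b) = infty_le a b.
  by case: a b => [a|] [b|] //=; apply: tau_le.
apply: infty_le_anti.
  have [->|/(gauss_lead vP)[k [-> _ _]]] := eqVneq f 0.
    by rewrite gauss0; case: (gauss_val _ _).
  by rewrite -tau_val (gauss_le vP).
rewrite malg_mapE; apply: (gauss_sum_ge vP) => k.
have := gauss_le vP f k; rewrite -tau_infty (gaussU vP) phi_tau.
by rewrite /monom_val; case: (v _) => //= a; rewrite raddfD.
Qed.

(** A nonzero element has finite value, and so has its image. *)
Lemma malg_map_inj : injective malg_map.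
Proof.
apply: raddf_inj => f /(congr1 (gauss_val v)); rewrite gauss0 gauss_map => e.
have wP := gauss_is_valuation vP; apply/eqP; rewrite -(valuation_eq0 wP).
by case: (gauss_val v f) e.
Qed.

End MonomialMap.

Section ValuedAutomorphism.
Variable K : valuedField.

Lemma vval_is_valuation : is_valuation (@vval K).
Proof. by split; [apply: vval_infty|apply: vvalM|apply: vvalD]. Qed.

Lemma induced_vgE (f : K -> K) (fA : valued_aut f) (x : K) g :
  vval x = Some g -> vval (f x) = Some (induced_vg f g).
Proof. by move=> e; rewrite vval_induced // e. Qed.

Lemma vval_lift (g : vg K) : exists x : K, vval x = Some g.
Proof. by have [x /eqP] := vval_surj g; exists x. Qed.

Lemma induced_vg_zmod (f : K -> K) :
  valued_aut f -> zmod_morphism (induced_vg f).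
Proof.
move=> fA g h; have [x ex] := vval_lift h; have [y ey] := vval_lift (g - h).
have exy : vval (x * y) = Some g by rewrite vvalM ex ey /= addrC subrK.
have := vvalM (f x) (f y); case: (fA) => _ _ <- _ _.
rewrite !(induced_vgE fA ex, induced_vgE fA ey, induced_vgE fA exy) => -[->].
by rewrite addrAC subrr add0r.
Qed.

Lemma induced_vg_le (f : K -> K) : valued_aut f ->
  forall g h, (induced_vg f g <= induced_vg f h) = (g <= h).
Proof.
move=> fA g h; have [x ex] := vval_lift (h - g).
have := induced_vgE fA ex; rewrite (induced_vg_zmod fA) => efx.
have : in_valring (@vval K) (f x) = in_valring (@vval K) x by case: fA.
by rewrite /in_valring ex efx /= !oag_subr_ge0.
Qed.

Lemma induced_vgK (f g : K -> K) : valued_aut f -> valued_aut g ->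
  cancel f g -> cancel (induced_vg f) (induced_vg g).
Proof.
move=> fA gA fK a; have [x ex] := vval_lift a.
by have := induced_vgE gA (induced_vgE fA ex); rewrite fK ex => -[].
Qed.

End ValuedAutomorphism.

(** * The Gauss extension of a valued difference field *)

Section GaussExtension.
Variable K : valuedField.
Local Notation A := {malg (vf K)[nneg (vg K)]}.
Local Notation L := {fraction A}.

Definition gauss_frac_val : L -> option (vg K) :=
  frac_val (gauss_val (@vval K)).

Lemma gauss_frac_valuation : is_valuation gauss_frac_val.
Proof. exact/frac_val_is_valuation/gauss_is_valuation/vval_is_valuation. Qed.

Definition const_frac : K -> L := @FracField.tofrac A \o malgC.
HB.instance Definition _ := GRing.RMorphism.on const_frac.

Lemma gauss_frac_const x : gauss_frac_val (const_frac x) = vval x.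
Proof.
rewrite /gauss_frac_val /const_frac /= frac_val_tofrac.
  by rewrite (gaussU (vval_is_valuation K)) infty_add0.
exact: gauss_is_valuation (vval_is_valuation K).
Qed.

Lemma gauss_frac_surj g : exists x, gauss_frac_val x == Some g.
Proof.
by have [x] := vval_surj g; exists (const_frac x); rewrite gauss_frac_const.
Qed.

Definition gauss_extension : valuedField :=
  valued_field gauss_frac_valuation gauss_frac_surj.

Section Automorphism.
Variables (f : K -> K) (fA : valued_aut f).

(** [aut_fun] and [aut_vg] carry the proof that f is an automorphism, so that
    their morphism structures can be inferred.  Everything is done for an
    arbitrary automorphism, to be applied both to sigma and to its inverse. *)
Definition aut_fun of valued_aut f : K -> K := f.
Definition aut_vg of valued_aut f : vg K -> vg K := induced_vg f.

Lemma aut_fun_zmod : zmod_morphism (aut_fun fA). Proof. by have [] := fA. Qed.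
Lemma aut_fun_monoid : monoid_morphism (aut_fun fA).
Proof.
have [f0 _ fM f_inj _] := fA; split=> //.
have f1 : f 1 != 0 by rewrite -f0 (inj_eq f_inj) oner_eq0.
by apply: (mulfI f1); rewrite /aut_fun -fM !mulr1.
Qed.
HB.instance Definition _ :=
  GRing.isZmodMorphism.Build _ _ (aut_fun fA) aut_fun_zmod.
HB.instance Definition _ :=
  GRing.isMonoidMorphism.Build _ _ (aut_fun fA) aut_fun_monoid.
HB.instance Definition _ :=
  GRing.isZmodMorphism.Build _ _ (aut_vg fA) (induced_vg_zmod fA).

Definition aut_malg : A -> A :=
  malg_map (aut_fun fA) (tau := aut_vg fA) (induced_vg_le fA).
HB.instance Definition _ := GRing.RMorphism.on aut_malg.

Definition aut_nneg : nneg (vg K) -> nneg (vg K) :=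
  nneg_map (tau := aut_vg fA) (induced_vg_le fA).

Lemma aut_malgE a : aut_malg a = \sum_(k <- msupp a) << f a@_k *g aut_nneg k >>.
Proof. exact: malg_mapE. Qed.

Lemma aut_malgU c k : aut_malg << c *g k >> = << f c *g aut_nneg k >>.
Proof. exact: malg_mapU. Qed.

Lemma aut_malg_val a :
  gauss_val (@vval K) (aut_malg a)
  = omap (induced_vg f) (gauss_val (@vval K) a).
Proof.
apply: gauss_map; first exact: vval_is_valuation.
by move=> x; apply: vval_induced.
Qed.

Lemma aut_malg_inj : injective aut_malg.
Proof.
apply: malg_map_inj; first exact: vval_is_valuation.
by move=> x; apply: vval_induced.
Qed.

Lemma aut_malg_eq0 a : (aut_malg a == 0) = (a == 0).
Proof. by rewrite -(inj_eq aut_malg_inj a) (rmorph0 aut_malg). Qed.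

Lemma tofrac_aut_inj : injective (@FracField.tofrac A \o aut_malg).
Proof. by move=> a b /= /eqP; rewrite tofrac_eq => /eqP/aut_malg_inj. Qed.

Definition aut_frac : L -> L := frac_lift tofrac_aut_inj.
HB.instance Definition _ := GRing.RMorphism.on aut_frac.

Lemma aut_fracE a b : b != 0 ->
  aut_frac (tofrac a / tofrac b)
  = tofrac (aut_malg a) / tofrac (aut_malg b).
Proof. exact: frac_liftE. Qed.

Lemma aut_frac_tofrac a :
  aut_frac (tofrac a) = tofrac (aut_malg a).
Proof. exact: frac_lift_tofrac. Qed.

Lemma aut_frac_val x :
  gauss_frac_val (aut_frac x) = omap (induced_vg f) (gauss_frac_val x).
Proof.
have wP := gauss_is_valuation (vval_is_valuation K).
have [a [b [b0 ->]]] := fractionP x; rewrite aut_fracE //.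
rewrite /gauss_frac_val (frac_valE wP) ?aut_malg_eq0 // (frac_valE wP) //.
apply: etrans (congr2 (fun c d => infty_add c (infty_opp d))
  (aut_malg_val a) (aut_malg_val b)) _.
case: (gauss_val _ a) => [g|] //.
case: (gauss_val _ b) => [h|] //.
by rewrite /= (induced_vg_zmod fA).
Qed.

Lemma aut_frac_valring x :
  in_valring gauss_frac_val (aut_frac x) = in_valring gauss_frac_val x.
Proof.
rewrite /in_valring aut_frac_val; case: (gauss_frac_val x) => //= g.
by rewrite -[RHS](induced_vg_le fA) -[X in X <= _](raddf0 (aut_vg fA)).
Qed.

Lemma aut_frac_const x : aut_frac (const_frac x) = const_frac (f x).
Proof.
rewrite /const_frac /= aut_frac_tofrac aut_malgU.
congr (tofrac << _ *g _ >>).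
by apply/val_inj; apply: (raddf0 (aut_vg fA)).
Qed.

End Automorphism.

Lemma aut_malgK (f g : K -> K) (fA : valued_aut f) (gA : valued_aut g) :
  cancel f g -> cancel (aut_malg fA) (aut_malg gA).
Proof.
move=> fK a; apply: etrans (congr1 (aut_malg gA) (aut_malgE fA a)) _.
apply: etrans (raddf_sum (aut_malg gA) _ _ _) _.
rewrite [RHS]monalgE; apply: eq_bigr => k _.
apply: etrans (aut_malgU gA _ _) _; rewrite fK.
congr << _ *g _ >>; apply/val_inj.
exact: (induced_vgK fA gA fK).
Qed.

Lemma aut_fracK (f g : K -> K) (fA : valued_aut f) (gA : valued_aut g) :
  cancel f g -> cancel (aut_frac fA) (aut_frac gA).
Proof.
move=> fK x; have [a [b [b0 ->]]] := fractionP x.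
have mb0 : aut_malg fA b != 0 by rewrite aut_malg_eq0.
apply: etrans (congr1 (aut_frac gA) (aut_fracE fA a b0)) _.
apply: etrans (aut_fracE gA _ mb0) _.
exact: (congr2 (fun c d => tofrac c / tofrac d)
  (aut_malgK fA gA fK a) (aut_malgK fA gA fK b)).
Qed.

End GaussExtension.

(** [valued_field] makes the value group of the extension equal to that of K by
    conversion, which is used silently below. *)
Definition gauss_vd (K : vdField) : vdField :=
  @VDField (gauss_extension K) (aut_frac (sigma_valued_aut K))
    (aut_frac (sigmaV_valued_aut K))
    (aut_fracK (sigma_valued_aut K) (sigmaV_valued_aut K) (@sigmaK K))
    (aut_fracK (sigmaV_valued_aut K) (sigma_valued_aut K) (@sigmaVK K))
    (aut_frac_valring (sigma_valued_aut K)).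

(** * Embeddings from morphisms of valued difference fields *)

Section ValuedField.
Variable L : valuedField.

Lemma in_valringN (x : L) :
  in_valring (@vval L) (- x) = in_valring (@vval L) x.
Proof. by rewrite /in_valring (valuationN (vval_is_valuation L)). Qed.

Lemma in_valringD (x y : L) :
  in_valring (@vval L) x -> in_valring (@vval L) y ->
  in_valring (@vval L) (x + y).
Proof. exact: (valuationD_ge (vval_is_valuation L)). Qed.

Lemma resB (x y : L) :
  in_valring (@vval L) x -> in_valring (@vval L) y ->
  res (x - y) = res x - res y.
Proof.
move=> xO yO; have NyO : in_valring (@vval L) (- y) by rewrite in_valringN.
apply/eqP; rewrite eq_sym subr_eq -resD ?subrK //; exact: in_valringD.
Qed.

Lemma res_lift (r : rf L) :
  exists2 x : L, in_valring (@vval L) x & res x = r.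
Proof. by have [x /andP[xO /eqP]] := res_surj r; exists x. Qed.

End ValuedField.

Section ResidueMap.
Variables (K N : valuedField) (iota : {rmorphism K -> N}).
Variable rho : {additive vg K -> vg N}.
Hypothesis rho_le : forall x y, (rho x <= rho y) = (x <= y).
Hypothesis iota_val : forall x, vval (iota x) = omap rho (vval x).

Lemma iota_valring x : in_valring (@vval N) (iota x) = in_valring (@vval K) x.
Proof.
rewrite /in_valring iota_val; case: (vval x) => //= g.
by rewrite -[RHS]rho_le raddf0.
Qed.

Definition res_map (r : rf K) : rf N := res (iota (xchoose (res_surj r))).

(** When x is in the valuation ring, the chosen lift of its residue differs from
    x by an element of the maximal ideal, which iota maps into the maximal ideal
    of N. *)
Lemma res_mapE x : res_map (res x) = res (iota x).
Proof.
have main z : in_valring (@vval K) z -> res_map (res z) = res (iota z).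
  move=> zO; rewrite /res_map; have /andP[] := xchooseP (res_surj (res z)).
  move: (xchoose _) => y yO /eqP ey.
  apply/eqP; rewrite -subr_eq0 -resB ?iota_valring // -rmorphB; apply/eqP.
  have dO : in_valring (@vval K) (y - z) by rewrite in_valringD ?in_valringN.
  apply/res_eq0; first by rewrite iota_valring.
  have : res (y - z) = 0 by rewrite resB // ey subrr.
  move/(res_eq0 dO); rewrite iota_val; case: (vval _) => //= g.
  by rewrite /infty_lt /= -rho_le raddf0.
have [/main //|xO] := boolP (in_valring (@vval K) x).
rewrite (res_out xO) [RHS]res_out ?iota_valring // -(res0 K) main.
  by rewrite rmorph0 res0.
by rewrite /in_valring vval0.
Qed.

Lemma res_map_zmod : zmod_morphism res_map.
Proof.
move=> r s; have [x xO <-] := res_lift r; have [y yO <-] := res_lift s.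
by rewrite -resB // !res_mapE rmorphB resB ?iota_valring.
Qed.

Lemma res_map_monoid : monoid_morphism res_map.
Proof.
split=> [|r s]; first by rewrite -(res1 K) res_mapE rmorph1 res1.
have [x xO <-] := res_lift r; have [y yO <-] := res_lift s.
by rewrite -resM // !res_mapE rmorphM resM ?iota_valring.
Qed.

End ResidueMap.

Section EmbeddingOfMorphism.
Variables (K N : vdField) (iota : {rmorphism K -> N}).
Variable rho : {additive vg K -> vg N}.
Hypothesis rho_le : forall x y, (rho x <= rho y) = (x <= y).
Hypothesis iota_val : forall x, vval (iota x) = omap rho (vval x).
Hypothesis iota_sigma : forall x, iota (sigma K x) = sigma N (iota x).

HB.instance Definition _ :=
  GRing.isZmodMorphism.Build _ _ (res_map iota) (res_map_zmod rho_le iota_val).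
HB.instance Definition _ :=
  GRing.isMonoidMorphism.Build _ _ (res_map iota)
    (res_map_monoid rho_le iota_val).

(** A field morphism compatible with the valuations and with sigma determines
    the maps on the other two sorts; the sort VG includes infinity, preserved
    by omap. *)
Definition morphism_embedding (s : lsort) : carrier K s -> carrier N s :=
  match s with
  | Fld VF => iota
  | Fld RF => res_map iota
  | VG => omap rho
  end.

Lemma iota_sigmaV x : iota (sigmaV x) = sigmaV (iota x).
Proof.
by apply: (can_inj (@sigmaK N)); rewrite sigmaVK -iota_sigma sigmaVK.
Qed.

Lemma morphism_embeddingP : embedding morphism_embedding.
Proof.
have rho_inj : injective rho.
  by move=> a b e; apply: le_anti; rewrite -rho_le -[X in _ && X]rho_le e lexx.
split.
- move=> [[]|]; [exact: fmorph_inj|exact: (fmorph_inj (res_map iota))|].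
  by move=> [a|] [b|] //= [/rho_inj ->].
- by case; [exact: rmorph0|exact: (rmorph0 (res_map iota))].
- by case; [exact: rmorph1|exact: (rmorph1 (res_map iota))].
- by case; [exact: rmorphD|exact: (rmorphD (res_map iota))].
- by case; [exact: rmorphN|exact: (rmorphN (res_map iota))].
- by case; [exact: rmorphM|exact: (rmorphM (res_map iota))].
- by case; [exact: fmorphV|exact: (fmorphV (res_map iota))].
- by rewrite /= raddf0.
- by [].
- by move=> [a|] [b|] //=; rewrite raddfD.
- by move=> [a|] //=; rewrite raddfN.
- by move=> [a|] [b|] //=; rewrite /infty_lt /= rho_le.
- by move=> x; rewrite /= iota_val.
- by move=> x; exact: (res_mapE rho_le iota_val).
- move=> [[]|]; first exact: iota_sigma.
    move=> r; have [x _ <-] := res_lift r; rewrite /= -res_sigma.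
    by rewrite !(res_mapE rho_le iota_val) iota_sigma res_sigma.
  move=> [g|] //; have [x ex] := vval_lift g.
  by rewrite -ex /= -vval_sigma -!iota_val iota_sigma vval_sigma.
- move=> [[]|]; first exact: iota_sigmaV.
    move=> r; have [x _ <-] := res_lift r; rewrite /= -res_sigmaV.
    by rewrite !(res_mapE rho_le iota_val) iota_sigmaV res_sigmaV.
  move=> [g|] //; have [x ex] := vval_lift g.
  by rewrite -ex /= -vval_sigmaV -!iota_val iota_sigmaV vval_sigmaV.
Qed.

End EmbeddingOfMorphism.

(** * The cross-section of the Gauss extension *)

Section CrossSection.
Variable K : vdField.
Local Notation A := {malg (vf K)[nneg (vg K)]}.
Local Notation L := (gauss_vd K).
Local Notation tofracA := (@FracField.tofrac A).
Implicit Types (g h : vg K) (a b : nneg (vg K)).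

Lemma gauss_embedding :
  embedding (morphism_embedding (N := L) (@const_frac K : {rmorphism K -> L})
    (idfun : {additive vg K -> vg L})).
Proof.
apply: morphism_embeddingP => // x.
  by rewrite /= gauss_frac_const; case: (vval x).
by apply/esym/aut_frac_const.
Qed.

Lemma pos_part_ge0 g : 0 <= (if 0 <= g then g else 0).
Proof. by case: ifP. Qed.

Lemma neg_part_ge0 g : 0 <= (if 0 <= g then 0 else - g).
Proof.
case: ifPn => // g0; rewrite -(oag_lerD2 g) addr0 subrr.
by case/orP: (oag_total g 0) => // h; rewrite h in g0.
Qed.

Definition monomial g : L :=
  tofracA << Nneg (pos_part_ge0 g) >> / tofracA << Nneg (neg_part_ge0 g) >>.

Lemma monom_neq0 a : tofracA << a >> != 0.
Proof. by rewrite tofrac_eq0 monalgU_eq0 oner_eq0. Qed.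

(** The monomial t^g may be computed from any way of writing g as a difference
    of nonnegative elements; this gives its additivity without a case analysis
    on signs. *)
Lemma monomialE g a b : nneg_val a - nneg_val b = g ->
  monomial g = tofracA << a >> / tofracA << b >>.
Proof.
move=> e; apply/eqP; rewrite eqr_div ?monom_neq0 // -!tofracM tofrac_eq.
rewrite !malgM_def !fgmulUU !mulr1; apply/eqP.
congr << _ *g _ >>; apply/val_inj.
rewrite /= -e; case: ifP => _; rewrite ?add0r ?subrK ?addr0 //.
by rewrite opprB addrC subrK.
Qed.

Lemma monomial_split g : exists a b, nneg_val a - nneg_val b = g /\
  monomial g = tofracA << a >> / tofracA << b >>.
Proof.
exists (Nneg (pos_part_ge0 g)), (Nneg (neg_part_ge0 g)); split=> //=.
by case: ifP => _; rewrite ?subr0 ?add0r ?opprK.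
Qed.

Lemma monomial_neq0 g : monomial g != 0.
Proof. by rewrite mulf_neq0 ?invr_eq0 ?monom_neq0. Qed.

Lemma monomialB g h : monomial (g - h) = monomial g / monomial h.
Proof.
have [a [b [eg ->]]] := monomial_split g.
have [c [d [eh ->]]] := monomial_split h.
rewrite (@monomialE _ (mmul a d) (mmul b c)); last first.
  by rewrite -eg -eh /= opprB opprD addrACA.
rewrite invf_div mulf_div -!tofracM; congr (tofracA _ / tofracA _).
  by rewrite malgM_def fgmulUU mulr1.
by rewrite malgM_def fgmulUU mulr1.
Qed.

Lemma monomial_val g : vval (monomial g) = Some g.
Proof.
have [a [b [<- ->]]] := monomial_split g.
rewrite /vval /= /gauss_frac_val frac_valE;
  last by rewrite monalgU_eq0 oner_eq0.
  rewrite !(gaussU (vval_is_valuation K)) vval1 /=; congr Some.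
  by rewrite !addr0.
exact: gauss_is_valuation (vval_is_valuation K).
Qed.

Lemma monomial_sigma g : monomial (sigma_vg g) = sigma L (monomial g).
Proof.
have [a [b [<- ->]]] := monomial_split g.
have b0 : << b >> != 0 :> A by rewrite monalgU_eq0 oner_eq0.
apply: etrans (esym (aut_fracE (sigma_valued_aut K) _ b0)).
rewrite !aut_malgU rmorph1; apply: monomialE.
exact: esym (induced_vg_zmod (sigma_valued_aut K) _ _).
Qed.

Lemma gauss_sigma_vg g : @sigma_vg L g = @sigma_vg K g.
Proof.
have := vval_sigma (monomial g).
by rewrite -monomial_sigma !monomial_val => -[].
Qed.

Definition cross_section g : mulgrp L := Mulgrp (monomial_neq0 g).

Lemma cross_section_zmod : zmod_morphism cross_section.
Proof. by move=> g h; apply/val_inj/monomialB. Qed.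

HB.instance Definition _ :=
  GRing.isZmodMorphism.Build _ _ cross_section cross_section_zmod.

Lemma gauss_cross_section : has_sigma_cross_section L.
Proof.
exists cross_section => g; split; first exact: monomial_val.
rewrite /= -monomial_sigma; congr monomial.
exact: gauss_sigma_vg.
Qed.

End CrossSection.

(** * Retraction onto the units *)

Section Projection.
Variables (L : vdField) (s : {additive vg L -> mulgrp L}).
Hypothesis s_val : forall g, vval (mg_val (s g)) = Some g.
Hypothesis s_sigma : forall g, mg_val (s (sigma_vg g)) = sigma L (mg_val (s g)).
Implicit Type z : mulgrp L.

Definition mg_vg z : vg L := odflt 0 (vval (mg_val z)).

Lemma mg_vgE z : vval (mg_val z) = Some (mg_vg z).
Proof.
rewrite /mg_vg; have [g ->] := valuation_fin (vval_is_valuation L) (mg_neq0 z).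
by [].
Qed.

Lemma mg_vg_zmod : zmod_morphism mg_vg.
Proof.
move=> x y.
have : vval (mg_val (x - y + y))
       = infty_add (vval (mg_val (x - y))) (vval (mg_val y)).
  exact: vvalM.
by rewrite subrK !mg_vgE => -[->]; rewrite addrK.
Qed.

HB.instance Definition _ := GRing.isZmodMorphism.Build _ _ mg_vg mg_vg_zmod.

Lemma mg_scaleX z : mg_val ('X *: z) = sigma L (mg_val z).
Proof. by rewrite /= -['X]mul1r zsigma_actMX zsigma_actC expr1z. Qed.

Lemma mg_scaleC c z : c%:P *: z = z *~ c.
Proof. by rewrite -[c in LHS]intz rmorph_int scaler_int. Qed.

(** The map z |-> s (v z) is additive and commutes with sigma, that is, with the
    action of 'X; constants act by integer multiples.  These generate the
    polynomial ring. *)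
Lemma section_vg_linear p z : s (mg_vg (p *: z)) = p *: s (mg_vg z).
Proof.
elim/poly_ind: p => [|p c IH]; first by rewrite !scale0r !raddf0.
rewrite !scalerDl !raddfD /= !mg_scaleC !raddfMz; congr (_ + _).
rewrite ![p * 'X]mulrC -!scalerA -IH; apply/val_inj.
rewrite [RHS]mg_scaleX -s_sigma; congr (mg_val (s _)).
by rewrite /mg_vg mg_scaleX vval_sigma mg_vgE.
Qed.

Definition unit_part z : mulgrp L := z - s (mg_vg z).

Lemma unit_part_valunits z : unit_part z \in @valunits L.
Proof.
by rewrite valunitsE mg_vgE raddfB /= /mg_vg s_val mg_vgE /= subrr.
Qed.

Lemma unit_part_id z : z \in @valunits L -> unit_part z = z.
Proof.
by rewrite valunitsE mg_vgE => /eqP[e]; rewrite /unit_part e raddf0 subr0.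
Qed.

Lemma unit_part_sum n (p : 'I_n -> {poly int}) (x : 'I_n -> mulgrp L) :
  unit_part (\sum_j p j *: x j) = \sum_j p j *: unit_part (x j).
Proof.
rewrite /unit_part (raddf_sum mg_vg) (raddf_sum s) -sumrB.
apply: eq_bigr => j _.
by rewrite section_vg_linear scalerBr.
Qed.

End Projection.

(** * The formula expressing solvability in units *)

Section Formula.
Variable V : lsort -> Type.
Local Notation tm := (term V (Fld VF)).
Implicit Types (t : tm) (p : {poly int}).

Definition tpow t (m : int) : tm :=
  match m with
  | Posz n => iter n (FMul t) (FOne V VF)
  | Negz n => FInv (iter n.+1 (FMul t) (FOne V VF))
  end.

(** Term counterpart of [zsigma_act], likewise [tcomb] for a row of the system.
    The big operators run over syntax; [big_morph] transports them to products
    in the field. *)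
Definition tact p t : tm :=
  \big[@FMul V VF/FOne V VF]_(i < size p)
     iter i (@TSigma V (Fld VF)) (tpow t p`_i).

Definition tcomb n (p : 'I_n -> {poly int}) (t : 'I_n -> tm) : tm :=
  \big[@FMul V VF/FOne V VF]_(j < n) tact (p j) (t j).

Definition qf_all I (r : seq I) (phi : I -> qf_formula V) : qf_formula V :=
  foldr (fun i => QAnd (phi i)) (QNot (QFalse V)) r.

Variables (K : vdField) (e : forall s, V s -> carrier K s).

Lemma eval_tpow t m : eval e (tpow t m) = (eval e t : K) ^ m.
Proof.
have h n : eval e (iter n (FMul t) (FOne V VF)) = (eval e t : K) ^+ n.
  by elim: n => [|n IH] //=; rewrite IH exprS.
case: m => n; first exact: h.
exact: (congr1 (@GRing.inv K) (h n.+1)).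
Qed.

Lemma eval_tact p t : eval e (tact p t) = zsigma_act p (eval e t : K).
Proof.
rewrite /tact (big_morph (fun u : tm => eval e u : K)
  (id1 := 1) (op1 := *%R)) //.
apply: eq_bigr => i _; rewrite -eval_tpow; move: (tpow _ _) => u.
by elim: (i : nat) => //= n ->.
Qed.

Lemma eval_tcomb n (p : 'I_n -> {poly int}) (t : 'I_n -> tm) :
  eval e (tcomb p t) = \prod_j zsigma_act (p j) (eval e (t j) : K).
Proof.
rewrite /tcomb (big_morph (fun u : tm => eval e u : K)
  (id1 := 1) (op1 := *%R)) //.
by apply: eq_bigr => j _; apply: eval_tact.
Qed.

Lemma holds_qf_all (I : eqType) (r : seq I) phi :
  holds e (qf_all r phi) <-> forall i, i \in r -> holds e (phi i).
Proof.
elim: r => [|i r IH] /=; first by split=> [_ i|_ []]; rewrite ?in_nil.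
split=> [[hi /IH hr] j|h].
  by rewrite inE => /predU1P[->|/hr].
split; first by apply: h; rewrite mem_head.
by apply/IH => j jr; apply: h; rewrite inE jr orbT.
Qed.

End Formula.

Definition vf_arity (n : nat) (s : lsort) : nat :=
  if s is Fld VF then n else 0.

(** The two other sorts have arity 0, so any value will do there. *)
Definition vf_tuple (K : vdField) n (x : 'I_n -> K) : stuple K (vf_arity n) :=
  fun s => match s return 'I_(vf_arity n s) -> carrier K s with
           | Fld VF => x
           | Fld RF => fun=> 0
           | VG => fun=> None
           end.

Section UnitSystem.
Variables (d n : nat) (A : 'M[{poly int}]_(d, n)).
Local Notation V := (vars2 (vf_arity n) (vf_arity d)).

Definition unknown (j : 'I_n) : term V (Fld VF) :=
  Var (inl j : vars2 (vf_arity n) (vf_arity d) (Fld VF)).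
Definition rhs (i : 'I_d) : term V (Fld VF) :=
  Var (inr i : vars2 (vf_arity n) (vf_arity d) (Fld VF)).

Definition unit_system : qf_formula V :=
  QAnd (qf_all (enum 'I_d) (fun i => QEq (tcomb (A i) unknown) (rhs i)))
       (qf_all (enum 'I_n) (fun j => QEq (TVal (unknown j)) (GZero V))).

Lemma holds_unit_system (K : vdField) (x : stuple K (vf_arity n))
    (y : stuple K (vf_arity d)) :
  holds (env2 x y) unit_system <->
  (forall i : 'I_d, \prod_j zsigma_act (A i j) (x (Fld VF) j : K)
    = y (Fld VF) i)
  /\ forall j : 'I_n, vval (x (Fld VF) j : K) = Some 0.
Proof.
rewrite /=; split=> [[/holds_qf_all h1 /holds_qf_all h2]|[h1 h2]].
  split=> [i|j]; last by apply: h2; rewrite mem_enum.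
  by have /= := h1 i; rewrite mem_enum eval_tcomb; apply.
split; apply/holds_qf_all => i _ /=; last exact: h2.
by rewrite eval_tcomb; apply: h1.
Qed.

End UnitSystem.

Lemma mg_val_sum (K : vdField) n (x : 'I_n -> mulgrp K) :
  mg_val (\sum_j x j) = \prod_j mg_val (x j).
Proof. exact: (big_morph (@mg_val K)). Qed.

(** * Purity *)

Section MultiplicativeMap.
Variables (K L : vdField) (f : forall s, carrier K s -> carrier L s).
Hypothesis fP : embedding f.

(** The proof fP is a parameter, so that the ring morphism structure can be
    inferred from it. *)
Definition vf_map of embedding f : K -> L := f (s := Fld VF).

Lemma vf_map_zmod : zmod_morphism (vf_map fP).
Proof. by move=> x y; rewrite /vf_map (emb_D fP) (emb_N fP). Qed.
Lemma vf_map_monoid : monoid_morphism (vf_map fP).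
Proof. by split; [exact: (emb_1 fP VF)|exact: (emb_M fP (s := VF))]. Qed.
HB.instance Definition _ :=
  GRing.isZmodMorphism.Build _ _ (vf_map fP) vf_map_zmod.
HB.instance Definition _ :=
  GRing.isMonoidMorphism.Build _ _ (vf_map fP) vf_map_monoid.

Lemma vf_map_act p x : vf_map fP (zsigma_act p x) = zsigma_act p (vf_map fP x).
Proof.
rewrite rmorph_prod; apply: eq_bigr => i _; rewrite -fmorphXz.
move: (_ ^ _) => y.
elim: (i : nat) => //= k IH; rewrite -IH.
exact: (emb_sigma fP (s := Fld VF)).
Qed.

Lemma mg_map_proof (z : mulgrp K) : vf_map fP (mg_val z) != 0.
Proof. by rewrite fmorph_eq0 mg_neq0. Qed.

Definition mg_map (z : mulgrp K) : mulgrp L := Mulgrp (mg_map_proof z).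

Lemma mg_map_sum n (p : 'I_n -> {poly int}) (x : 'I_n -> mulgrp K) :
  mg_map (\sum_j p j *: x j) = \sum_j p j *: mg_map (x j).
Proof.
apply/val_inj; rewrite /= !mg_val_sum rmorph_prod.
by apply: eq_bigr => j _; apply: vf_map_act.
Qed.

Lemma mg_map_valunits z : z \in @valunits K -> mg_map z \in @valunits L.
Proof.
by rewrite !valunitsE /= /vf_map -(emb_val fP) => /eqP ->; rewrite (emb_vg0 fP).
Qed.

End MultiplicativeMap.

(** The solution c found in K is carried to L, corrected there by [unit_part],
    which fixes b since b consists of units, and the existence of a solution in
    units is then pulled back to K. *)
Lemma existentially_closed_pure (K L : vdField)
    (f : forall s, carrier K s -> carrier L s) :
  existentially_closed K -> embedding f -> has_sigma_cross_section L ->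
  @pure_submodule {poly int} (mulgrp K) (@valunits K).
Proof.
move=> Kec fP [s sP]; split; first exact: valunits_submod.
move=> d n A b bU [c cb].
have s_val g : vval (mg_val (s g)) = Some g by have [] := sP g.
have s_sigma g : mg_val (s (sigma_vg g)) = sigma L (mg_val (s g)).
  by have [] := sP g.
pose x j := unit_part s (mg_map fP (c j)).
have xb i : \sum_j A i j *: x j = mg_map fP (b i).
  rewrite -(unit_part_sum s_sigma) -mg_map_sum cb unit_part_id //.
  exact: mg_map_valunits.
have [|y /holds_unit_system[yb yU]] := Kec L f fP (vf_arity n) (vf_arity d)
    (vf_tuple (fun i => mg_val (b i))) (unit_system A).
  exists (vf_tuple (fun j => mg_val (x j))); apply/holds_unit_system.
  split=> /= [i|j].
    by have /(congr1 (@mg_val L)) := xb i; rewrite mg_val_sum.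
  have := unit_part_valunits s_val (mg_map fP (c j)).
  by rewrite valunitsE => /eqP.
have y0 j : (y (Fld VF) j : K) != 0.
  by rewrite -(valuation_eq0 (vval_is_valuation K)) yU.
exists (fun j => Mulgrp (y0 j)); split=> [j|i].
  by rewrite valunitsE /= yU.
by apply/val_inj; rewrite /= mg_val_sum; apply: yb.
Qed.

Theorem theoremA :
  (forall K : vdField, existentially_closed K ->
    @pure_submodule {poly int} (mulgrp K) (@valunits K))
  /\
  (forall K : vdField,
    exists (L : vdField) (f : forall s, carrier K s -> carrier L s),
      embedding f /\ has_sigma_cross_section L).
Proof.
have ext (K : vdField) := conj (gauss_embedding K) (gauss_cross_section K).
split=> K; last by eexists; eexists; apply: ext K.
move=> Kec; have [fP sP] := ext K.
exact: existentially_closed_pure Kec fP sP.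
Qed.
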